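(* Let $\mathcal C$ be a class of topological semigroups with $\mathsf{T_{z}S}\subseteq\mathcal C\subseteq\mathsf{T_{1}S}$. For a commutative semigroup $X$ the following are equivalent: (1) $X$ is projectively $\mathcal C$-closed; (2) $X$ is ideally $\mathcal C$-closed; (3) $X$ is chain-finite, almost Clifford, and all subgroups of $X$ are bounded.
   Context: $\mathsf{T_{1}S}$: class of $T_1$ topological semigroups; $\mathsf{T_{z}S}$: class of Hausdorff zero-dimensional topological semigroups. A topological semigroup $X$ is $\mathcal C$-closed if for every isomorphic topological embedding $h:X\to Y$ into $Y\in\mathcal C$ the image $h[X]$ is closed in $Y$; a semigroup is $\mathcal C$-closed if it is so with the discrete topology. A semigroup $X$ is projectively $\mathcal C$-closed if for every congruence $\approx$ on $X$ the quotient semigroup $X/_\approx$ is $\mathcal C$-closed; it is ideally $\mathcal C$-closed if for every ideal $I\subseteq X$ (a subset with $IX\cup XI\subseteq I$, possibly empty) the Rees quotient $X/I$ (obtained by collapsing $I$ to a point; $X/\emptyset=X$) is $\mathcal C$-closed. The Clifford part $H(X)$ is the union of all subgroups of $X$; $X$ is almost Clifford if $X\setminus H(X)$ is finite. A semigroup is chain-finite if it contains no infinite subset $C$ with $xy\in\{x,y\}$ for all $x,y\in C$. A group is bounded if there is $n\ge1$ with $x^n$ equal to the identity for all $x$. *)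

(* Defs.v *)
From HB Require Import structures.
From mathcomp Require Import all_boot all_order.
From mathcomp Require Import boolp classical_sets cardinality topology.
Set Implicit Arguments. Unset Strict Implicit. Unset Printing Implicit Defensive.
Local Open Scope classical_set_scope.

Definition semigroup (X : Type) (mul : X -> X -> X) : Prop :=
  forall x y z, mul x (mul y z) = mul (mul x y) z.

Definition commutative_semigroup (X : Type) (mul : X -> X -> X) : Prop :=
  semigroup mul /\ forall x y, mul x y = mul y x.

(* x^n for n >= 1, encoded as  spow x n = x^(n+1) *)
Fixpoint spow (X : Type) (mul : X -> X -> X) (x : X) (n : nat) : X :=
  match n with 0 => x | n'.+1 => mul x (spow mul x n') end.

Definition is_subgroup_with (X : Type) (mul : X -> X -> X) (G : set X) (e : X) : Prop :=
  [/\ G e,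
      (forall x y, G x -> G y -> G (mul x y)),
      (forall x, G x -> mul e x = x /\ mul x e = x) &
      (forall x, G x -> exists2 y, G y & mul x y = e /\ mul y x = e)].

Definition is_subgroup (X : Type) (mul : X -> X -> X) (G : set X) : Prop :=
  exists e, is_subgroup_with mul G e.

Definition clifford_part (X : Type) (mul : X -> X -> X) : set X :=
  [set x | exists G, is_subgroup mul G /\ G x].

Definition almost_clifford (X : Type) (mul : X -> X -> X) : Prop :=
  finite_set (~` clifford_part mul).

Definition bounded_subgroup (X : Type) (mul : X -> X -> X) (G : set X) : Prop :=
  exists e, is_subgroup_with mul G e /\
    exists n : nat, forall x, G x -> spow mul x n = e.

Definition all_subgroups_bounded (X : Type) (mul : X -> X -> X) : Prop :=
  forall G, is_subgroup mul G -> bounded_subgroup mul G.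

Definition is_chain (X : Type) (mul : X -> X -> X) (C : set X) : Prop :=
  forall x y, C x -> C y -> mul x y = x \/ mul x y = y.

Definition chain_finite (X : Type) (mul : X -> X -> X) : Prop :=
  forall C, is_chain mul C -> finite_set C.

Definition congruence (X : Type) (mul : X -> X -> X) (R : X -> X -> Prop) : Prop :=
  [/\ (forall x, R x x), (forall x y, R x y -> R y x),
      (forall x y z, R x y -> R y z -> R x z) &
      (forall x y a, R x y -> R (mul a x) (mul a y) /\ R (mul x a) (mul y a))].

(* ideal, possibly empty *)
Definition ideal (X : Type) (mul : X -> X -> X) (I : set X) : Prop :=
  forall x a, I x -> I (mul x a) /\ I (mul a x).

(* the Rees congruence of I: its quotient is X/I (and X/emptyset = X) *)
Definition rees_congr (X : Type) (I : set X) : X -> X -> Prop :=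
  fun x y => x = y \/ (I x /\ I y).

Definition topological_semigroup (Y : topologicalType) (mul : Y -> Y -> Y) : Prop :=
  semigroup mul /\ continuous (fun p : Y * Y => mul p.1 p.2).

Definition zero_dim (Y : topologicalType) : Prop :=
  forall (x : Y) (U : set Y), open U -> U x ->
    exists V : set Y, [/\ open V, closed V, V x & V `<=` U].

Definition T1S (Y : topologicalType) (mul : Y -> Y -> Y) : Prop :=
  topological_semigroup mul /\ @accessible_space Y.

Definition TzS (Y : topologicalType) (mul : Y -> Y -> Y) : Prop :=
  [/\ topological_semigroup mul, hausdorff_space Y & zero_dim Y].

Definition semigroup_class := forall Y : topologicalType, (Y -> Y -> Y) -> Prop.

Definition discrete_subspace (Y : topologicalType) (A : set Y) : Prop :=
  forall y, A y -> exists U : set Y, open U /\ U `&` A = [set y].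

(* The quotient semigroup X/R (R a congruence), with the discrete topology,
   is C-closed.  An isomorphic topological embedding of the discrete
   semigroup X/R into Y is exactly a homomorphism h : X -> Y with
   (h x = h y <-> R x y) whose image is a discrete subspace of Y;
   its image is h[X]. *)
Definition quotient_C_closed (C : semigroup_class) (X : Type)
    (mul : X -> X -> X) (R : X -> X -> Prop) : Prop :=
  forall (Y : topologicalType) (mulY : Y -> Y -> Y), C Y mulY ->
  forall h : X -> Y,
    (forall x y, h (mul x y) = mulY (h x) (h y)) ->
    (forall x y, h x = h y <-> R x y) ->
    discrete_subspace (range h) ->
    closed (range h).

Definition projectively_C_closed (C : semigroup_class) (X : Type)
    (mul : X -> X -> X) : Prop :=
  forall R, congruence mul R -> quotient_C_closed C mul R.

Definition ideally_C_closed (C : semigroup_class) (X : Type)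
    (mul : X -> X -> X) : Prop :=
  forall I, ideal mul I -> quotient_C_closed C mul (rees_congr I).

(* Main.v *)
Require Import Defs.
From HB Require Import structures.
From mathcomp Require Import all_boot all_order.
From mathcomp Require Import boolp classical_sets cardinality topology.
From mathcomp Require Import zify.
Set Implicit Arguments. Unset Strict Implicit. Unset Printing Implicit Defensive.
Local Open Scope classical_set_scope.

(**
Necessity. A semigroup S with a family of sets behaving like a base of clopen sets, for which
multiplication is continuous, has a Kolmogorov quotient that is a Hausdorff zero-dimensional
topological semigroup; so it suffices to adjoin to X/I formal limits of elements of X/I.
Along a free ultrafilter, one can adjoin a limit of an injective sequence (a_n) that is a chain, or
that lies outside I with all products a_i a_j inside I; this gives chain-finiteness and a
nonsingularity property of all Rees quotients. If the powers of x are distinct, or if the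
maximal subgroup at e is unbounded, one chooses a sparse sequence (g_n) among these elements
and adjoins words u a^k, where the neighbourhoods of u a^k are obtained by replacing some factors
a by g_n with n large; here I consists of the elements dividing no power of x (resp. not e).
Finally, from infinitely many non-Clifford elements, Ramsey's theorem applied to
divisibility extracts a sequence contradicting nonsingularity.

Sufficiency. The conditions pass to the image Q of X in Y. Let y be a limit of an ultrafilter on Q,
y not in Q. After replacing y by ye for a minimal idempotent e with ye not in Q, the ultrafilter
avoids every maximal subgroup (boundedness), hence yy is not in Q; for a maximal idempotent g
with yg = c in Q and g below almost all units, yv = cc holds for almost all v, so yy = cc.
*)

(** * Ultrafilters and Ramsey's theorem *)

Lemma history_choice (T : Type) (Q : seq T -> T -> Prop) :
  (forall s, exists t, Q s t) -> exists f : nat -> T, forall n, Q (mkseq f n) (f n).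
Proof.
move=> /choice[g Qg]; pose hist := fix hist n := if n is m.+1 then rcons (hist m) (g (hist m)) else [::].
exists (g \o hist) => n /=; suff -> : mkseq (g \o hist) n = hist n by exact: Qg.
by elim: n => // n IH; rewrite mkseqS IH.
Qed.

Definition free_ultrafilter (T : Type) (U : set_system T) :=
  UltraFilter U /\ forall x, U [set y | y <> x].

Lemma finite_setP_seq (T : Type) (A : set T) :
  finite_set A -> exists s : seq {classic T}, A = [set x : T | (x : {classic T}) \in s].
Proof. by move=> /(@finite_seqP {classic T}). Qed.

Lemma free_filter_finite (T : Type) (F : set_system T) (A : set T) :
  Filter F -> (forall x, F [set y | y <> x]) -> finite_set A -> F (~` A).
Proof.
move=> FF Ffree /finite_setP_seq[s ->]; elim: s => [|x s IH].
  by apply: filterS filterT.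
apply: filterS (filterI IH (Ffree x)) => y [/= ys yx].
by rewrite inE => /orP[/eqP|].
Qed.

Lemma infinite_injection (T : Type) (A : set T) : infinite_set A ->
  exists2 a : nat -> T, injective a & forall n, A (a n).
Proof.
move=> Ainf; have [f fQ] : exists f : nat -> {classic T},
    forall n, A (f n) /\ f n \notin mkseq f n.
  apply: (@history_choice {classic T} (fun s t => A t /\ t \notin s)) => s.
  have [x [Ax xs]] := infinite_setN0 (infinite_setD Ainf (finite_seq s)).
  by exists x; split => //; apply/negP.
exists f => [i j fij|n]; last by case: (fQ n).
wlog ij : i j fij / i < j.
  move=> H; case: (ltngtP i j) => // ij; first exact: H.
  by apply/esym; apply: H.
by case: (fQ j) => _; rewrite -fij map_f // mem_iota.
Qed.

Lemma injection_infinite (T : Type) (A : set T) (a : nat -> T) :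
  injective a -> (forall n, A (a n)) -> infinite_set A.
Proof.
move=> ainj aA; apply: (@sub_infinite_set _ (range a)); first by move=> _ [n _ <-].
by rewrite (eq_finite_set (inj_card_eq (in2W ainj))); exact: infinite_nat.
Qed.

Lemma free_ultrafilter_nat : exists U : set_system nat, free_ultrafilter U.
Proof.
pose F : set_system nat := [set A | exists n, forall m, n <= m -> A m].
have FF : ProperFilter F.
  apply: Build_ProperFilter_ex; last split.
  - by move=> A [n An]; exists n; apply: An.
  - by exists 0.
  - move=> A B [n An] [m Bm]; exists (maxn n m) => k.
    by rewrite geq_max => /andP[nk mk]; split; [exact: An|exact: Bm].
  - by move=> A B AB [n An]; exists n => m /An/AB.
have [U [UU FU]] := ultraFilterLemma FF.
exists U; split => // n; apply: FU; exists n.+1 => m /= nm; lia.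
Qed.

Section Ultra.
Variables (T : Type) (U : set_system T).
Hypothesis UU : UltraFilter U.

Lemma ultra_notN (P : set T) : ~ U P <-> U (~` P).
Proof.
split=> [nP|UnP UP]; first by case: (in_ultra_setVsetC P UU).
have : U (P `&` ~` P) by apply: filterI.
by rewrite setICr; apply: filter_not_empty.
Qed.

Lemma ultra_ex (P : set T) : U P -> exists x, P x.
Proof. exact: filter_ex. Qed.

End Ultra.

(** Up to negating [P], almost every [i] satisfies [P i j] for almost every [j]. Such [i] are picked
    greedily, each from the finite intersection of the large sets attached to the earlier ones. *)
Lemma ramsey_pairs (P : nat -> nat -> Prop) : exists2 f : nat -> nat,
  (forall i j, i < j -> f i < f j) &
  (forall i j, i < j -> P (f i) (f j)) \/ (forall i j, i < j -> ~ P (f i) (f j)).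
Proof.
have [U [UU Ufree]] := free_ultrafilter_nat.
have Ugt n : U [set m | n < m].
  elim: n => [|n IH]; first by apply: filterS (Ufree 0) => m /= ?; lia.
  by apply: filterS (filterI IH (Ufree n.+1)) => m /= [? ?]; lia.
wlog UK : P / U [set i | U [set j | P i j]].
  move=> H; case: (in_ultra_setVsetC [set i | U [set j | P i j]] UU) => [/H //|UK].
  case: (H (fun i j => ~ P i j)).
    by apply: filterS UK => i /= /(ultra_notN UU).
  move=> f fm [fP|fP]; exists f => //; first by right.
  by left=> i j ij; apply: contrapT; exact: fP.
pose K := [set i | U [set j | P i j]].
have [f fQ] : exists f : nat -> nat, forall n, (forall i, i \in mkseq f n -> K i) ->
    K (f n) /\ forall i, i \in mkseq f n -> i < f n /\ P i (f n).
  apply: (@history_choice _ (fun s t => (forall i, i \in s -> K i) ->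
    K t /\ forall i, i \in s -> i < t /\ P i t)) => s.
  have [sK|] := pselect (forall i, i \in s -> K i); last by exists 0.
  suff /(ultra_ex UU) : U (K `&` [set t | forall i, i \in s -> i < t /\ P i t]).
    by move=> []// t [Kt st]; exists t.
  apply: filterI => //; elim: s sK => [_|i s IH sK]; first by apply: filterS filterT.
  have Us : U [set t | forall i, i \in s -> i < t /\ P i t].
    by apply: IH => j js; apply: sK; rewrite inE js orbT.
  apply: filterS (filterI (filterI (Ugt i) (sK i (mem_head _ _))) Us).
  by move=> t [[it Pit] H] j; rewrite inE => /orP[/eqP->|/H].
have fK n : K (f n).
  elim/ltn_ind: n => n IH; case: (fQ n) => // i /mapP[j].
  by rewrite mem_iota => /= jn ->; exact: IH.
have H i j : i < j -> f i < f j /\ P (f i) (f j).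
  move=> ij; case: (fQ j) => [k /mapP[l _ ->] //|_]; apply.
  by apply: map_f; rewrite mem_iota.
by exists f => [i j /H[]|]; last by left=> i j /H[].
Qed.

(** * Commutative semigroups *)

Section CommutativeSemigroup.
Variables (X : Type) (mul : X -> X -> X).
Hypothesis hX : commutative_semigroup mul.
Local Notation "x * y" := (mul x y).
Local Notation pow := (spow mul).

Lemma csgA : associative mul. Proof. by case: hX. Qed.
Lemma csgC : commutative mul. Proof. by case: hX. Qed.

Lemma csgCA : left_commutative mul. Proof. by move=> x y z; rewrite csgA (csgC x) -csgA. Qed.

Lemma csgAC : right_commutative mul. Proof. by move=> x y z; rewrite -!csgA (csgC y). Qed.

Lemma csgACA : interchange mul mul. Proof. by move=> x y z t; rewrite -!csgA (csgCA y). Qed.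

Lemma spowD x m n : pow x (m + n).+1 = pow x m * pow x n.
Proof.
elim: m => // m IH; rewrite addSn -[LHS]/(x * pow x (m + n).+1) IH.
by rewrite csgA.
Qed.

Lemma spowMl x y n : pow (x * y) n = pow x n * pow y n.
Proof. by elim: n => //= n ->; rewrite csgACA. Qed.

Lemma spow_spow x m n : pow (pow x m) n = pow x (m.+1 * n.+1)%N.-1.
Proof.
elim: n => [|n IH]; first by rewrite muln1.
by rewrite [LHS]/= IH -spowD; congr pow; lia.
Qed.

Definition idem e := e * e = e.

(** For idempotent [e], the maximal subgroup at [e]. The inverse [y] may lie outside it; [y * e] is
    then an inverse inside. *)
Definition unit_group e : set X := [set x | x * e = x /\ exists y, x * y = e].

Lemma idem_spow e n : idem e -> pow e n = e.
Proof. by move=> ee; elim: n => //= n ->. Qed.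

Lemma idemM e f : idem e -> idem f -> idem (e * f).
Proof. by rewrite /idem => ee ff; rewrite csgACA ee ff. Qed.

Lemma unit_group_id e : idem e -> unit_group e e.
Proof. by move=> ee; split=> //; exists e. Qed.

Lemma unit_groupM e f x y : idem e -> idem f ->
  unit_group e x -> unit_group f y -> unit_group (e * f) (x * y).
Proof.
move=> ee ff [xe [x' xx']] [yf [y' yy']]; split.
  by rewrite csgACA xe yf.
by exists (x' * y'); rewrite csgACA xx' yy'.
Qed.

Lemma unit_group_inj e f x : unit_group e x -> unit_group f x -> e = f.
Proof.
move=> [xe [x' xx']] [xf [x'' xx'']].
have <- : e * f = e by rewrite -xx' csgAC xf.
by rewrite -[in RHS]xx'' -xe csgAC xx'' csgC.
Qed.

Lemma unit_group_inv e x : idem e -> unit_group e x -> exists2 y, unit_group e y & x * y = e.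
Proof.
move=> ee [xe [y xy]]; exists (y * e); last by rewrite csgA xy.
split; first by rewrite -csgA ee.
by exists x; rewrite csgC csgA xy.
Qed.

Lemma unit_group_subgroup e : idem e -> is_subgroup_with mul (unit_group e) e.
Proof.
move=> ee; split; first exact: unit_group_id.
- by move=> x y xG yG; rewrite -ee; apply: unit_groupM.
- by move=> x [xe _]; rewrite csgC.
- by move=> x /(unit_group_inv ee)[y Gy xy]; exists y => //; rewrite (csgC y).
Qed.

Lemma subgroup_sub_unit_group G e : is_subgroup_with mul G e ->
  idem e /\ G `<=` unit_group e.
Proof.
move=> [Ge GM Gid Ginv]; split; first by case: (Gid e Ge).
by move=> x Gx; split; [case: (Gid x Gx)|case: (Ginv x Gx) => y _ []; exists y].
Qed.

Lemma clifford_partE x : clifford_part mul x <-> exists2 e, idem e & unit_group e x.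
Proof.
split=> [[G [[e Ge] Gx]]|[e ee Gx]].
  by have [ee Gsub] := subgroup_sub_unit_group Ge; exists e => //; exact: Gsub.
by exists (unit_group e); split => //; exists e; exact: unit_group_subgroup.
Qed.

Lemma all_subgroups_boundedE : all_subgroups_bounded mul <->
  forall e, idem e -> exists n, forall x, unit_group e x -> pow x n = e.
Proof.
split=> [H e ee|H G [e Ge]].
  have [|f [Gf [n Hn]]] := H (unit_group e); first by exists e; exact: unit_group_subgroup.
  have [ff fsub] := subgroup_sub_unit_group Gf.
  exists n => x /Hn ->; apply: (@unit_group_inj _ _ e); last exact: unit_group_id.
  exact/fsub/unit_group_id.
have [ee Gsub] := subgroup_sub_unit_group Ge; have [n Hn] := H e ee.
by exists e; split => //; exists n => x /Gsub/Hn.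
Qed.

Lemma spow_unit_group e x n : idem e -> x * e = x -> pow x n = e -> unit_group e x.
Proof.
move=> ee xe xn; split => //; exists (pow x (n + n)).
by rewrite -[LHS]/(pow x (n + n).+1) spowD xn.
Qed.

Lemma spow_collision x m p : pow x m = pow x (m + p).+1 -> exists n, idem (pow x n).
Proof.
move=> H; have step k : m <= k -> pow x k = pow x (k + p).+1.
  move=> mk; case: (ltngtP m k) mk => // [mk _|<-//].
  have -> : k = (m + (k - m.+1)).+1 by lia.
  by rewrite spowD H -spowD; congr pow; lia.
have steps k j : m <= k -> pow x k = pow x (k + j * p.+1)%N.
  move=> mk; elim: j => [|j IH]; first by rewrite addn0.
  by rewrite IH step; [congr pow|]; lia.
(* From exponent m+1 on, the powers have period p+1; the exponent (m+1)(p+1) is a multiple of the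
   period in that range. *)
exists (m.+1 * p.+1)%N.-1; rewrite /idem -spowD [in RHS](steps _ m.+1); last by lia.
congr pow; lia.
Qed.

(** Without an extremal element, dependent choice gives a strictly [r]-monotone sequence, an
    infinite chain. Taking [r e f] to be [e * f = f] yields minimal idempotents, [e * f = e] maximal
    ones. *)
Lemma idem_extremum (r : X -> X -> Prop) (P : set X) :
  chain_finite mul -> (forall e, P e -> idem e) -> P !=set0 ->
  (forall e f, r e f -> e * f = e \/ e * f = f) ->
  (forall e f g, r e f -> r f g -> r e g) -> (forall e f, r e f -> r f e -> e = f) ->
  exists2 e, P e & forall f, P f -> r e f -> f = e.
Proof.
move=> cf Pid [e0 Pe0] rch rtr rasym; apply: contrapT => H.
have next (e : {e | P e}) : exists f : {e | P e}, r (sval e) (sval f) /\ sval f <> sval e.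
  case: e => e Pe; apply: contrapT => H1; apply: H; exists e => // f Pf ef.
  by apply: contrapT => fe; apply: H1; exists (exist _ f Pf).
have [nx nxP] := choice next.
pose f n := sval (iter n nx (exist _ e0 Pe0)).
have fP n : P (f n) by rewrite /f; case: (iter _ _ _).
have fS n : r (f n) (f n.+1) /\ f n.+1 <> f n by exact: nxP.
have fr i j : i < j -> r (f i) (f j).
  elim: j => // j IH; rewrite ltnS leq_eqVlt => /orP[/eqP->|/IH ij].
    by case: (fS j).
  by apply: rtr ij _; case: (fS j).
have finj i j : i < j -> f i <> f j.
  move=> ij eij; have [ri ni] := fS i; apply: ni.
  move: ij; rewrite leq_eqVlt => /orP[/eqP->//|/fr]; rewrite -eij => rj.
  exact: rasym.
apply: (@injection_infinite _ (range f) f) => [i j eij|n|]; last 1 first.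
- apply: cf => _ _ [i _ <-] [j _ <-]; case: (ltngtP i j) => [/fr/rch//|/fr/rch|->].
    by rewrite csgC => -[]; [right|left].
  by left; apply: Pid.
- by case: (ltngtP i j) => // /finj; rewrite eij.
- by exists n.
Qed.

(** Divisibility in the semigroup with an identity adjoined. *)
Definition divides x y := y = x \/ exists z, y = x * z.

Lemma divides_refl x : divides x x. Proof. by left. Qed.

Lemma divides_mulr x y : divides x (x * y). Proof. by right; exists y. Qed.

Lemma divides_mull x y : divides x (y * x). Proof. by right; exists y; rewrite csgC. Qed.

Lemma divides_trans y x z : divides x y -> divides y z -> divides x z.
Proof.
move=> [->//|[t ->]] [->|[u ->]]; first exact: divides_mulr.
by rewrite -csgA; exact: divides_mulr.
Qed.

Lemma divides_mul x y z t : divides x y -> divides z t -> divides (x * z) (y * t).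
Proof.
move=> xy zt; apply: (@divides_trans (y * z)).
  case: xy => [->|[u ->]]; first exact: divides_refl.
  by rewrite csgAC; exact: divides_mulr.
case: zt => [->|[u ->]]; first exact: divides_refl.
by rewrite csgA; exact: divides_mulr.
Qed.

Lemma divides_spow x y n : divides x y -> divides (pow x n) (pow y n).
Proof. by move=> xy; elim: n => //= n; exact: divides_mul. Qed.

Lemma divides_idem e x : idem e -> divides e x -> x * e = x.
Proof. by move=> ee [->//|[z ->]]; rewrite csgAC ee. Qed.

Lemma not_dividing_ideal (Z : set X) : ideal mul [set x | forall z, Z z -> ~ divides x z].
Proof.
move=> x a xZ; split=> z /xZ xz; apply: contra_not xz; apply: divides_trans.
  exact: divides_mulr.
exact: divides_mull.
Qed.

End CommutativeSemigroup.

(** * Kolmogorov quotients *)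

Record clopen_base (S : Type) (m : S -> S -> S) (B : set_system S) : Prop := ClopenBase {
  clopen_base_assoc : associative m;
  clopen_base_cover : forall y, exists2 V, B V & V y;
  clopen_baseI : forall V W y, B V -> B W -> V y -> W y ->
    exists T, [/\ B T, T y, T `<=` V & T `<=` W];
  clopen_baseC : forall V y, B V -> ~ V y -> exists W, [/\ B W, W y & W `&` V = set0];
  clopen_base_mul : forall W y z, B W -> W (m y z) -> exists V V',
    [/\ B V, B V', V y, V' z & forall r s, V r -> V' s -> W (m r s)] }.

Section KolmogorovQuotient.
Variables (S : Type) (m : S -> S -> S) (B : set_system S).
Hypothesis hB : clopen_base m B.

Definition trace (y : S) : set_system S := [set V | B V /\ V y].

(** Encoding a point by the basic sets containing it turns topological indistinguishability into
    equality. *)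
Record kolmogorov : Type := Kolmogorov {
  ktrace : set_system S;
  ktraceP : exists y, ktrace = trace y }.

HB.instance Definition _ := gen_eqMixin kolmogorov.
HB.instance Definition _ := gen_choiceMixin kolmogorov.

Definition kproj (y : S) : kolmogorov := Kolmogorov (ex_intro _ y erefl).

Lemma ktrace_inj : injective ktrace.
Proof. by move=> [p hp] [q hq] /= pq; case: _ / pq in hq *; congr Kolmogorov; exact: Prop_irrelevance. Qed.

Definition krepr (q : kolmogorov) : S := projT1 (cid (ktraceP q)).

Lemma kreprK q : kproj (krepr q) = q.
Proof. by apply: ktrace_inj; rewrite /krepr; case: cid. Qed.

Lemma kproj_eq y z : kproj y = kproj z <-> forall V, B V -> V y <-> V z.
Proof.
split=> [[yz] V BV|H].
  by split=> Vy; [have : trace y V|have : trace z V] => //; [rewrite yz|rewrite -yz] => -[].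
by apply: ktrace_inj; apply/seteqP; split=> V [BV Vy]; split => //; apply/(H V BV).
Qed.

(** Clopenness makes specialization symmetric: a basic set containing [z] but not [y] would be
    disjoint from a basic neighbourhood of [y], which contains [z]. *)
Lemma kproj_ge y z : (forall V, B V -> V y -> V z) -> kproj y = kproj z.
Proof.
move=> H; apply/kproj_eq => V BV; split; first exact: H.
move=> Vz; apply: contrapT => nVy; have [W [BW Wy WV]] := clopen_baseC hB BV nVy.
by have : (W `&` V) z; [split => //; exact: H|rewrite WV].
Qed.

Definition kmul (p q : kolmogorov) : kolmogorov := kproj (m (krepr p) (krepr q)).

Lemma krepr_kproj V y : B V -> V (krepr (kproj y)) <-> V y.
Proof. by move=> BV; apply: (kproj_eq _ _).1 => //; exact: kreprK. Qed.

Lemma kmulE y z : kmul (kproj y) (kproj z) = kproj (m y z).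
Proof.
apply/esym/kproj_ge => W BW /(clopen_base_mul hB BW)[V [V' [BV BV' Vy Vz]]].
by apply; [apply/krepr_kproj|apply/krepr_kproj].
Qed.

Definition kopen : set_system kolmogorov :=
  [set O | forall y, O (kproj y) -> exists V, [/\ B V, V y & forall z, V z -> O (kproj z)]].

Lemma kopenT : kopen setT.
Proof. by move=> y _; have [V BV Vy] := clopen_base_cover hB y; exists V. Qed.

Lemma kopenI : setI_closed kopen.
Proof.
move=> O O' oO oO' y [/oO[V [BV Vy VO]] /oO'[V' [BV' Vy' VO']]].
have [T [BT Ty TV TV']] := clopen_baseI hB BV BV' Vy Vy'.
by exists T; split => // z Tz; split; [exact/VO/TV|exact/VO'/TV'].
Qed.

Lemma kopen_bigcup (I : Type) (f : I -> set kolmogorov) :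
  (forall i, kopen (f i)) -> kopen (\bigcup_i f i).
Proof.
move=> of_ y [i _ /of_[V [BV Vy Vf]]]; exists V; split => // z Vz.
by exists i => //; exact: Vf.
Qed.

HB.instance Definition _ := isOpenTopological.Build kolmogorov kopenT kopenI kopen_bigcup.

Definition kolmogorov_quotient : topologicalType := kolmogorov.

Lemma kopenE (O : set kolmogorov) : open O = kopen O. Proof. by []. Qed.

Definition kbase (V : set S) : set kolmogorov := [set q | V (krepr q)].

Lemma kbase_kproj V y : B V -> kbase V (kproj y) <-> V y.
Proof. exact: krepr_kproj. Qed.

Lemma kbase_open V : B V -> open (kbase V).
Proof.
move=> BV; rewrite kopenE => y /(kbase_kproj _ BV) Vy; exists V; split => // z Vz.
exact/kbase_kproj.
Qed.

Lemma kbase_closed V : B V -> closed (kbase V).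
Proof.
move=> BV; rewrite -[kbase V]setCK; apply: open_closedC; rewrite kopenE => y /(kbase_kproj _ BV) nVy.
have [W [BW Wy WV]] := clopen_baseC hB BV nVy; exists W; split => // z Wz.
move=> /(kbase_kproj _ BV) Vz; by have : (W `&` V) z; [|rewrite WV].
Qed.

Lemma knbhs (y : S) (O : set kolmogorov) : nbhs (kproj y) O <->
  exists V, [/\ B V, V y & forall z, V z -> O (kproj z)].
Proof.
split=> [|[V [BV Vy VO]]].
  rewrite nbhsE => -[A [+ Ay] AO]; rewrite kopenE => oA; have [V [BV Vy VA]] := oA y Ay.
  by exists V; split => // z /VA/AO.
rewrite nbhsE; exists (kbase V); first by split; [exact: kbase_open|exact/kbase_kproj].
by move=> q; rewrite -[q]kreprK => /(kbase_kproj _ BV)/VO.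
Qed.

Lemma kolmogorov_TzS : @TzS kolmogorov_quotient kmul.
Proof.
split; [split|..].
- move=> p q r; rewrite -[p]kreprK -[q]kreprK -[r]kreprK !kmulE.
  by rewrite (clopen_base_assoc hB).
- move=> [p q]; rewrite -[p]kreprK -[q]kreprK => O /=; rewrite kmulE.
  move=> /knbhs[W [BW Wpq WO]].
  have [V [V' [BV BV' Vp Vq VW]]] := clopen_base_mul hB BW Wpq.
  exists (kbase V, kbase V') => /=.
    split; apply/knbhs.
      by exists V; split => // z Vz; apply/kbase_kproj.
    by exists V'; split => // z Vz; apply/kbase_kproj.
  move=> [r s] /= []; rewrite -[r]kreprK -[s]kreprK.
  by move=> /(kbase_kproj _ BV) Vr /(kbase_kproj _ BV') Vs; rewrite kmulE; exact/WO/VW.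
- move=> p q; rewrite -[p]kreprK -[q]kreprK => pq; apply: kproj_ge => V BV Vp.
  apply: contrapT => nVq; have [W [BW Wq WV]] := clopen_baseC hB BV nVq.
  have [||r []] := pq (kbase V) (kbase W).
  + by apply/knbhs; exists V; split => // z Vz; apply/kbase_kproj.
  + by apply/knbhs; exists W; split => // z Wz; apply/kbase_kproj.
  rewrite -[r]kreprK => /(kbase_kproj _ BV) Vr /(kbase_kproj _ BW) Wr.
  by have : (W `&` V) (krepr r); [|rewrite WV].
- move=> p O; rewrite kopenE -[p]kreprK => oO /oO[V [BV Vp VO]]; exists (kbase V); split.
  + exact: kbase_open.
  + exact: kbase_closed.
  + exact/kbase_kproj.
  + by move=> q; rewrite -[q]kreprK => /(kbase_kproj _ BV)/VO.
Qed.

End KolmogorovQuotient.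

(** The criterion behind all nonclosedness arguments. In the Kolmogorov quotient of [S] the image of
    [h] is a discrete copy of X/R, while [a] lies in its closure and outside it. *)
Lemma not_quotient_C_closed (C : semigroup_class)
  (hTz : forall (Y : topologicalType) (mulY : Y -> Y -> Y), TzS mulY -> C Y mulY)
  (X : Type) (mul : X -> X -> X) (R : X -> X -> Prop)
  (S : Type) (m : S -> S -> S) (B : set_system S) (h : X -> S) (a : S) :
  clopen_base m B ->
  (forall x y, h (mul x y) = m (h x) (h y)) ->
  (forall x y, R x y -> forall V, B V -> V (h x) -> V (h y)) ->
  (forall x, exists V, [/\ B V, V (h x) & forall y, V (h y) -> R x y]) ->
  (forall V, B V -> V a -> exists x, V (h x)) ->
  (forall x, exists V, [/\ B V, V (h x) & ~ V a]) ->
  ~ quotient_C_closed C mul R.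
Proof.
move=> hB hM hR hd ha hna.
pose kh x : kolmogorov_quotient hB := kproj B (h x).
move=> /(_ _ (kmul m (B := B)) (hTz _ _ (kolmogorov_TzS hB)) kh) clo.
have {clo} : closed (range kh); first apply: clo.
- by move=> x y; rewrite /kh hM (kmulE hB).
- move=> x y; split=> [/kproj_eq xy|xy].
    by have [V [BV Vx]] := hd x; apply; apply/xy.
  by apply: (kproj_ge hB) => V BV; apply: hR xy _ BV.
- move=> _ [x _ <-]; have [V [BV Vx VR]] := hd x; exists (kbase V); split.
    exact: kbase_open.
  apply/seteqP; split=> [q [Vy [y _ yE]]|q ->]; last by split; [apply/kbase_kproj|exists x].
  move: Vy; rewrite -yE => /(kbase_kproj _ BV) Vy.
  by apply/esym/(kproj_ge hB) => W BW; apply: hR (VR _ _) W BW.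
move=> /(_ (kproj B a)) []; last first.
  move=> x _ xa; have [V [BV Vx]] := hna x; apply.
  by apply/((kproj_eq _ _ _).1 xa).
move=> O /(knbhs hB)[V [BV Va VO]]; have [x Vx] := ha V BV Va.
by exists (kproj B (h x)); split; [exists x|exact: VO].
Qed.

(** * Limits along an ultrafilter *)

Section SequenceExtension.
Variables (X : Type) (mul : X -> X -> X).
Hypothesis hX : commutative_semigroup mul.
Local Notation pow := (spow mul).
Variables (I : set X) (a : nat -> X).
Hypothesis Iideal : ideal mul I.
Hypothesis ainj : injective a.
Hypothesis aI : forall n, ~ I (a n).
Hypothesis amul : (forall i j, mul (a i) (a j) = a i \/ mul (a i) (a j) = a j) \/
  (forall i j, I (mul (a i) (a j))).

Definition omul (u v : option X) : option X :=
  match u, v with Some x, Some y => Some (mul x y) | None, _ => v | _, None => u end.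

Definition opow (x : X) (k : nat) : option X := if k is k'.+1 then Some (pow x k') else None.

Lemma omulA : associative omul.
Proof. by move=> [x|] [y|] [z|] //=; rewrite (csgA hX). Qed.

Lemma omulC : commutative omul.
Proof. by move=> [x|] [y|] //=; rewrite (csgC hX). Qed.

Lemma omulACA : interchange omul omul.
Proof. by move=> x y z t; rewrite -!omulA; congr omul; rewrite !omulA (omulC y). Qed.

Lemma opowD x k l : opow x (k + l) = omul (opow x k) (opow x l).
Proof.
case: k l => [//|k] [|l]; first by rewrite addn0.
by rewrite /= -(spowD hX) addnS.
Qed.

Definition oideal : set (option X) := [set t | if t is Some x then I x else False].

Lemma oidealM t u : oideal t -> oideal (omul t u).
Proof. by case: t u => [x|//] [y|//] /= /(Iideal y)[]. Qed.

(** Sets containing [oideal] or disjoint from it, that is, preimages from the Rees quotient. *)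
Definition saturated (W : set (option X)) := forall t, oideal t -> W t -> oideal `<=` W.

(* The point [(u, k)] stands for [u a^k], where [a] is the limit of [a_n] along [U], and [None]
   for an adjoined identity; the base consists of the traces of the clopen sets of the
   Stone-Cech compactification. *)
Definition term (y : option X * nat) (n : nat) := omul y.1 (opow (a n) y.2).

Definition term_mul (y z : option X * nat) := (omul y.1 z.1, (y.2 + z.2)%N).

Lemma term_mulE y z n : term (term_mul y z) n = omul (term y n) (term z n).
Proof. by rewrite /term opowD omulACA. Qed.

(** For a chain, a_i a_j is a_i or a_j, so the mixed product is one of the two diagonal ones. In the
    nil case with both exponents positive, mixed and diagonal products all lie in the ideal, and
    saturation applies. *)
Lemma term_mul_mixed W y z i j : saturated W ->
  W (term (term_mul y z) i) -> W (term (term_mul y z) j) -> W (omul (term y i) (term z j)).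
Proof.
case: y z => [y k] [z l] satW; rewrite /term /term_mul /= omulACA; move: (omul y z) => u.
case: k l => [//|k] [|l] /=; first by rewrite addn0.
have powD x : pow x (k + l.+1) = mul (pow x k) (pow x l) by rewrite addnS (spowD hX).
rewrite !powD; case: amul => [chain|nil].
  have ai n m : pow (a n) m = a n by apply: idem_spow; rewrite /idem; case: (chain n n).
  rewrite !ai; have idm n : mul (a n) (a n) = a n by case: (chain n n).
  by rewrite !idm; case: (chain i j) => ->.
have oi i' j' : oideal (omul (Some (mul (pow (a i') k) (pow (a j') l))) u).
  apply: oidealM; rewrite /=; elim: l {powD} => [|l IHl] /=.
    elim: k => [|k IHk] /=; first exact: nil.
    by rewrite -(csgA hX); have [] := Iideal (a i') IHk.
  by rewrite (csgCA hX); have [] := Iideal (a j') IHl.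
by rewrite -!(omulC (Some _)) => Wi _; apply: satW Wi _ (oi _ _); exact: oi.
Qed.

Variable U : set_system nat.
Hypothesis Ufree : free_ultrafilter U.
Let UU : UltraFilter U := Ufree.1.
#[local] Existing Instance UU.

Definition term_set (W : set (option X)) : set (option X * nat) :=
  [set y | U [set n | W (term y n)]].

Definition term_base : set_system (option X * nat) :=
  [set V | exists2 W, saturated W & V = term_set W].

Lemma term_clopen_base : clopen_base term_mul term_base.
Proof.
split.
- by move=> [u k] [v l] [w m]; rewrite /term_mul /= omulA addnA.
- move=> y; exists (term_set setT); last by apply: filterS filterT.
  by exists setT.
- move=> _ _ y [W satW ->] [W' satW' ->] Wy Wy'; exists (term_set (W `&` W')); split.
  + by exists (W `&` W') => // t It [Wt W't] s Is; split; [exact: satW Wt _ Is|exact: satW' W't _ Is].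
  + exact: filterI.
  + by move=> z; apply: filterS => n [].
  + by move=> z; apply: filterS => n [].
- move=> _ y [W satW ->] nWy; exists (term_set (~` W)); split.
  + exists (~` W) => // t It nWt s Is Ws; apply: nWt; exact: satW Ws _ It.
  + exact/(ultra_notN UU).
  + rewrite -subset0 => z [/(ultra_notN UU)]; exact.
- move=> _ y z [W satW ->] UK; pose K := [set n | W (term (term_mul y z) n)].
  (* The saturation of the set of values of [term x] on [K]. *)
  pose hull x := [set t | (exists2 n, K n & t = term x n) \/
    oideal t /\ exists2 n, K n & oideal (term x n)].
  have hullP x : term_base (term_set (hull x)) /\ term_set (hull x) x.
    split; last by apply: filterS UK => n Kn; left; exists n.
    exists (hull x) => // t It xt s Is; right; split => //.
    by case: xt => [[n Kn tE]|[]//]; exists n => //; rewrite -tE.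
  exists (term_set (hull y)), (term_set (hull z)); split; try by case: (hullP y); case: (hullP z).
  move=> r s yr zs; apply: filterS (filterI yr zs) => n /= [].
  rewrite term_mulE => yn zn.
  have IW t x i : K i -> oideal (term x i) -> x = y \/ x = z -> oideal t -> W t.
    move=> Ki Ix xyz It; apply: (satW _ _ Ki) => //; rewrite term_mulE.
    by case: xyz Ix => -> Ix; [|rewrite omulC]; exact: oidealM.
  case: yn => [[i Ki ->]|[It [i Ki Iy]]]; last first.
    by apply: (IW _ y i) => //; [left|exact: oidealM].
  case: zn => [[j Kj ->]|[It [j Kj Iz]]]; first exact: term_mul_mixed.
  by apply: (IW _ z j) => //; [right|rewrite omulC; exact: oidealM].
Qed.

Lemma term_not_closed (C : semigroup_class) :
  (forall (Y : topologicalType) (mulY : Y -> Y -> Y), TzS mulY -> C Y mulY) ->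
  ~ quotient_C_closed C mul (rees_congr I).
Proof.
move=> hTz; pose W x : set (option X) := [set t | t = Some x \/ I x /\ oideal t].
have satW x : saturated (W x).
  by move=> t It [tE|[Ix _]] s Is; right; split => //; rewrite tE in It.
apply: (not_quotient_C_closed hTz (h := fun x => (Some x, 0)) (a := (None, 1)) term_clopen_base).
- by [].
- move=> x y xy _ [V satV ->] /(ultra_ex UU)[n]; rewrite /term /= => Vx.
  apply: filterS filterT => m _ /=; rewrite /term /=.
  by case: xy => [<-//|[Ix Iy]]; apply: satV Vx _ _.
- move=> x; exists (term_set (W x)); split; first by exists (W x).
    by apply: filterS filterT => n _; left.
  move=> y /(ultra_ex UU)[n]; rewrite /term /= => -[[->]|[Ix Iy]]; first by left.
  by right.
- move=> _ [V satV ->] /(ultra_ex UU)[n Vn]; exists (a n).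
  by apply: filterS filterT => m _.
- move=> x; exists (term_set (W x)); split; first by exists (W x).
    by apply: filterS filterT => n _; left.
  move=> Wa; have [n Wn] := ultra_ex UU Wa.
  have aE m : W x (term (None, 1) m) -> a m = x by move=> [[]|[_ /aI]].
  have [m [Wm /= mn]] := ultra_ex UU (filterI Wa (Ufree.2 n)).
  by apply: mn; apply: ainj; rewrite !aE.
Qed.

End SequenceExtension.

(** * Graded extensions *)

Lemma seq_ubound (s : seq nat) : exists b, all (fun i => i < b) s.
Proof.
elim: s => [|i s [b sb]]; first by exists 0.
exists (maxn i.+1 b) => /=; rewrite leq_max leqnn /=; apply: sub_all sb => j jb.
by rewrite leq_max jb orbT.
Qed.

Lemma seq_max (s : seq nat) : s <> [::] -> exists2 q, q \in s & all (fun i => i <= q) s.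
Proof.
elim: s => // i [|j s] IH _; first by exists i; rewrite ?inE //= leqnn.
have [//|q qs sq] := IH; have [iq|qi] := leqP i q.
  by exists q; [rewrite inE qs orbT|rewrite /= iq].
exists i; first exact: mem_head.
by rewrite /= leqnn; apply: sub_all sq => k kq; exact: leq_trans kq (ltnW qi).
Qed.

Section GradedExtension.
Variables (X : Type) (mul : X -> X -> X).
Hypothesis hX : commutative_semigroup mul.
Local Notation "x * y" := (mul x y).
Local Notation pow := (spow mul).
(* [T n] is a decreasing family of multipliers: either [{x^r | r >= n}] or constantly a subgroup.
   Points [u], [v] are to have the same limit [u a = v a] exactly when [eqv u v]. *)
Variables (I : set X) (T : nat -> set X).
Hypothesis Iideal : ideal mul I.
Hypothesis IM : forall x y, ~ I x -> ~ I y -> ~ I (x * y).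
Hypothesis TI : forall n x, T n x -> ~ I x.
Hypothesis T_decr : forall m n, m <= n -> T n `<=` T m.

Definition eqv (u v : X) := exists m, forall g, T m g -> u * g = v * g.

Hypothesis eqv_cancel : forall s x y, ~ I s -> eqv (x * s) (y * s) -> eqv x y.
Hypothesis T_avoid : forall n (F : seq {classic X}), exists2 g, T n g &
  forall u v, u \in F -> v \in F -> ~ I u -> ~ I v -> forall c, c < n -> ~ eqv u (v * pow g c).

Lemma eqv_refl x : eqv x x. Proof. by exists 0. Qed.

Lemma eqv_sym x y : eqv x y -> eqv y x.
Proof. by case=> m xy; exists m => g /xy. Qed.

Lemma eqv_trans y x z : eqv x y -> eqv y z -> eqv x z.
Proof.
move=> [m xy] [n yz]; exists (maxn m n) => g Tg.
by rewrite xy ?yz //; [exact: T_decr (leq_maxr _ _) _ Tg|exact: T_decr (leq_maxl _ _) _ Tg].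
Qed.

Lemma eqvMr x y z : eqv x y -> eqv (x * z) (y * z).
Proof. by case=> m xy; exists m => g /xy; rewrite -!(csgA hX) !(csgCA hX _ z) => ->. Qed.

Lemma eqvM x y z t : eqv x y -> eqv z t -> eqv (x * z) (y * t).
Proof.
move=> xy zt; apply: (@eqv_trans (y * z)); first exact: eqvMr.
by rewrite !(csgC hX y); exact: eqvMr.
Qed.

(** All products of [x] with at most [n] factors from [s], as a finite list to which [T_avoid]
    applies. *)
Fixpoint word_values (s : seq {classic X}) (x : {classic X}) n : seq {classic X} :=
  if n is n'.+1 then word_values s x n' ++ [seq mul u z | u <- word_values s x n', z <- s]
  else [:: x].

Definition act (g : nat -> X) (x : X) (s : seq nat) : X := foldl (fun u i => u * g i) x s.

Lemma act_word_values (g : nat -> {classic X}) q n x (t : seq nat) :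
  all (fun i => i < q) t -> size t <= n -> (act g x t : {classic X}) \in word_values (mkseq g q) x n.
Proof.
elim: n t => [|n IH] t; first by case: t => // _ _; rewrite inE.
case: (lastP t) => [_ _|{}t i].
  have := IH [::] erefl erefl; rewrite /= mem_cat => ->//.
rewrite all_rcons size_rcons ltnS => /andP[iq tq] tn; rewrite /= mem_cat; apply/orP; right.
apply/(@allpairsP {classic X} {classic X}).
exists ((act g x t : {classic X}), g i); split; first exact: IH.
  by apply: map_f; rewrite mem_iota.
by rewrite /act foldl_rcons.
Qed.

(** [T_avoid] keeps each new term out of all relations between short words in the earlier terms.
    Every word starts with [g 0], so that the empty word has a value even if [X] has no identity. *)
Lemma sparse_sequence : exists g : nat -> X, forall q, T q (g q) /\
  forall s t c, all (fun i => i < q) s -> all (fun i => i < q) t -> size s <= q -> size t <= q ->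
    c < q -> ~ eqv (act g (g 0) s) (act g (g 0) t * pow (g q) c).
Proof.
pose W (s : seq {classic X}) := if s is x :: _ then word_values s x (size s) else [::].
have [|g gP] := @history_choice {classic X} (fun s t => T (size s) t /\
  forall u v, u \in W s -> v \in W s -> ~ I u -> ~ I v ->
    forall c, c < size s -> ~ eqv u (v * pow t c)).
  by move=> s; have [t Tt H] := T_avoid (size s) (W s); exists t.
exists g => q; have [Tq Hq] := gP q; rewrite size_mkseq in Tq Hq; split => // s t c sq tq ss ts cq.
have gI n : ~ I (g n) by case: (gP n) => /TI.
have actI x r : ~ I x -> ~ I (act g x r).
  by elim: r x => //= i r IH x Ix; apply/IH/IM.
have WE : W (mkseq g q) = word_values (mkseq g q) (g 0) q.
  by case: q cq {Tq Hq sq tq ss ts} => // q _; rewrite /W -[LHS]/(word_values _ _ (size _)) size_mkseq.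
by apply: Hq => //; rewrite ?WE; try exact: act_word_values; exact: actI.
Qed.

Section Graded.
Variable g : nat -> X.
Hypothesis gT : forall n, T n (g n).
Hypothesis g_sparse : forall q s t c, all (fun i => i < q) s -> all (fun i => i < q) t ->
  size s <= q -> size t <= q -> c < q -> ~ eqv (act g (g 0) s) (act g (g 0) t * pow (g q) c).
Local Notation act := (act g).

Lemma gI n : ~ I (g n). Proof. exact: TI (gT n). Qed.

Lemma actI x s : ~ I x -> ~ I (act x s).
Proof. by elim: s x => //= i s IH x Ix; apply/IH/IM => //; exact: gI. Qed.

Lemma act_mull x y s : act (x * y) s = act x s * y.
Proof. by elim: s x => //= i s IH x; rewrite -IH; congr act; rewrite -!(csgA hX) (csgC hX y). Qed.

Lemma act_cat x s t : act x (s ++ t) = act (act x s) t.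
Proof. exact: foldl_cat. Qed.

Lemma act_nseq x q c : act x (nseq c.+1 q) = x * pow (g q) c.
Proof. by elim: c x => // c IH x; rewrite [LHS]IH /= (csgA hX). Qed.

Lemma act_rem x q s : q \in s -> act x s = act x (rem q s) * g q.
Proof.
rewrite -act_mull; elim: s x => //= i s IH x; rewrite inE eq_sym; case: eqVneq => [->//|_ /= qs].
by rewrite IH // -!(csgA hX) (csgC hX (g q)).
Qed.

Lemma act_filter x q s :
  act x s = act (act x [seq i <- s | i != q]) (nseq (count_mem q s) q).
Proof.
elim: s x => //= i s IH x; rewrite IH; case: eqVneq => //= ->.
by rewrite -act_mull.
Qed.

Lemma eqv_act x y s : eqv x y -> eqv (act x s) (act y s).
Proof. by elim: s x y => //= i s IH x y xy; apply/IH/eqvMr. Qed.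

Lemma eqv_act_cancel x y s : eqv (act x s) (act y s) -> eqv x y.
Proof. by elim: s x y => //= i s IH x y /IH; apply: eqv_cancel; exact: gI. Qed.

Lemma eqv_act_eq x y : eqv x y -> exists m, forall s, s <> [::] ->
  all (fun i => m <= i) s -> act x s = act y s.
Proof.
move=> [m xy]; exists m => -[//|i s] _ /= /andP[mi _]; congr act; apply: xy.
exact: T_decr mi _ (gT i).
Qed.

(* Multiplying the assumed relation by a fixed relation [act x A ~ act y B] and cancelling
   [x * y] leaves a relation between words in [g] only, excluded by sparseness. *)
Lemma sparse_separated x y L : ~ I x -> ~ I y -> exists m, forall q s t c, m <= q ->
  all (fun i => i < q) s -> all (fun i => i < q) t -> size s <= L -> size t <= L -> c < L ->
  ~ eqv (act x s) (act y t * pow (g q) c).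
Proof.
move=> Ix Iy; have [[A [B AB]]|nAB] := pselect (exists A B, eqv (act x A) (act y B)); last first.
  exists 0 => q s t c _ _ _ _ _ _; rewrite -act_nseq -act_cat => H.
  by apply: nAB; exists s, (t ++ nseq c.+1 q).
have [b] := seq_ubound (A ++ B); rewrite all_cat => /andP[Ab Bb].
exists (maxn b (L + size A + size B)) => q s t c; rewrite geq_max => /andP[bq Lq] sq tq sL tL cL H.
have lt_b r : all (fun i => i < b) r -> all (fun i => i < q) r.
  by apply: sub_all => i ib; exact: leq_trans ib bq.
apply: (@g_sparse q (s ++ B) (t ++ A) c); rewrite ?all_cat ?size_cat ?sq ?tq ?lt_b //; try lia.
apply: (@eqv_cancel (x * y)); first exact: IM.
have := eqvMr (g 0) (eqvM H (eqv_sym AB)).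
have E u v r r' : act u r * act v r' * g 0 = act (g 0) (r ++ r') * (u * v).
  rewrite act_cat (csgC hX (act u r)) -(csgA hX) -!act_mull (csgC hX v) -act_mull.
  by congr (act (act _ _) _); rewrite (csgC hX u) -(csgA hX).
rewrite E.
have -> : act y t * pow (g q) c * act x A * g 0 = act (g 0) (t ++ A) * pow (g q) c * (x * y).
  by rewrite (csgAC hX (act y t)) (csgAC hX _ (pow _ _)) E (csgAC hX) (csgC hX x).
by [].
Qed.

(** Induction on the length of [t], looking at the largest letter [q] of [s ++ t]. Unequal
    multiplicities of [q] would leave, after cancellation, a relation excluded by
    [sparse_separated]; so [q] occurs in both words and one copy is removed from each. What remains
    of [s] is [s']. *)
Lemma sparse_cancel x y L : ~ I x -> ~ I y -> exists m, forall s t,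
  size s <= L -> size t <= L -> all (fun i => m <= i) t -> eqv (act x s) (act y t) ->
  exists s', [/\ {subset s' <= s}, (size s' + size t)%N = size s & eqv (act x s') y].
Proof.
move=> Ix Iy; have [m Hm] := sparse_separated L Ix Iy; have [n Hn] := sparse_separated L Iy Ix.
exists (maxn m n) => s t; move: {2}(size t) (leqnn (size t)) => N.
elim: N s t => [|N IH] s t tN sL tL tm st.
  by exists s; split => //; case: t tN {tL tm} st => //= _; rewrite addn0.
have [t0|tn0] := pselect (t = [::]); first by apply: IH => //; rewrite t0.
have [|q qst stq] := @seq_max (s ++ t); first by case: (s) => //; exact: tn0.
have {tn0} mq : maxn m n <= q.
  case: t tn0 tm stq {tN tL st qst} => // i t _ /= /andP[mi _].
  by rewrite all_cat /= => /and3P[_ iq _]; exact: leq_trans mi iq.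
move: mq; rewrite geq_max => /andP[mq nq].
have ltq r : {subset r <= s ++ t} -> all (fun i => i < q) [seq i <- r | i != q].
  move=> rst; apply/allP => i; rewrite mem_filter => /andP[/= iq /rst ist].
  by rewrite ltn_neqAle iq; exact: (allP stq).
have ltqs := ltq s (mem_subseq (prefix_subseq s t)); have ltqt := ltq t (mem_subseq (suffix_subseq s t)).
have le_filter r : size r <= L -> size [seq i <- r | i != q] <= L.
  by apply: leq_trans; rewrite size_filter count_size.
have := st; rewrite (act_filter _ q s) (act_filter _ q t).
have cs := leq_trans (count_size (pred1 q) s) sL; have ct := leq_trans (count_size (pred1 q) t) tL.
case: (ltngtP (count_mem q s) (count_mem q t)) => [ab|ba|ab] H.
- exfalso; pose c := (count_mem q t - count_mem q s).-1.
  have tE : count_mem q t = (c.+1 + count_mem q s)%N by rewrite /c; lia.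
  move: H; rewrite tE nseqD act_cat => /eqv_act_cancel; rewrite act_nseq.
  by apply: Hm; rewrite ?le_filter //; lia.
- exfalso; pose c := (count_mem q s - count_mem q t).-1.
  have sE : count_mem q s = (c.+1 + count_mem q t)%N by rewrite /c; lia.
  move: H; rewrite sE nseqD act_cat => /eqv_act_cancel/eqv_sym; rewrite act_nseq.
  by apply: Hn; rewrite ?le_filter //; lia.
- have qs : q \in s.
    by move: qst; rewrite mem_cat -!has_pred1 !has_count ab orbb.
  have qt : q \in t by rewrite -has_pred1 has_count -ab -has_count has_pred1.
  move: st; rewrite (act_rem _ qs) (act_rem _ qt) => /eqv_cancel-/(_ (@gI q)) st.
  have [||||s' [s's ss' xs']] := IH (rem q s) (rem q t) _ _ _ _ st.
  + by rewrite size_rem // -subn1 leq_subLR.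
  + by rewrite size_rem //; apply: leq_trans sL; exact: leq_pred.
  + by rewrite size_rem //; apply: leq_trans tL; exact: leq_pred.
  + by apply/allP => i /mem_rem; exact: (allP tm).
  exists s'; split => // [i /s's/mem_rem//|].
  move: ss'; rewrite !size_rem //; case: (s) qs => // i s1 _; case: (t) qt => // j t1 _ /= <-.
  by rewrite addnS.
Qed.

Definition graded_mul (y z : X * nat) : X * nat := (y.1 * z.1, (y.2 + z.2)%N).

(** In degree 0 points are elements of [X]; in positive degree only the limits u a^k count, and
    these agree up to [eqv]. *)
Definition level_eq (k : nat) (u v : X) := if k is 0 then u = v else eqv u v.

Lemma level_eq_refl k u : level_eq k u u. Proof. by case: k => //= k; exact: eqv_refl. Qed.

Lemma level_eqW k u v : level_eq k u v -> eqv u v.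
Proof. by case: k => //= ->; exact: eqv_refl. Qed.

Lemma level_eqM k l u v u' v' :
  level_eq k u v -> level_eq l u' v' -> level_eq (k + l) (u * u') (v * v').
Proof.
case: k l => [|k] [|l] /=; first by move=> -> ->.
- by move=> -> /(eqvM (eqv_refl v)).
- by move=> uv ->; exact: eqvMr.
- exact: eqvM.
Qed.

(* The point [(u, k)] stands for [u a^k], with [a] the limit of the sequence [g]. *)
Definition gball (m : nat) (y : X * nat) : set (X * nat) :=
  [set z | (I y.1 /\ I z.1) \/ [/\ ~ I y.1, ~ I z.1 & exists s,
    [/\ all (fun i => m <= i) s, (z.2 + size s)%N = y.2 & level_eq z.2 (act y.1 s) z.1]]].

Lemma gball_refl m y : gball m y y.
Proof.
have [Iy|Iy] := pselect (I y.1); first by left.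
by right; split => //; exists [::]; split; [|exact: addn0|exact: level_eq_refl].
Qed.

Lemma gball_decr m n y : m <= n -> gball n y `<=` gball m y.
Proof.
move=> mn z [Iyz|[Iy Iz [s [sn yz zs]]]]; [by left|right; split => //; exists s; split => //].
by apply: sub_all sn => i; exact: leq_trans.
Qed.

(** Replacements compose by concatenating words. Where a relation [eqv] in positive degree must
    become an equality in degree 0, the later letters are taken beyond the threshold of
    [eqv_act_eq]. *)
Lemma gball_open m y z : gball m y z -> exists n, gball n z `<=` gball m y.
Proof.
move=> [[Iy Iz]|[Iy Iz [s [sm yz zs]]]].
  by exists 0 => w [[_ Iw]|[]//]; left.
case: z Iz yz zs => v [|j] /= Iv yz zs.
  exists 0 => -[w i] [[]//|[_ Iw [t [_ /= /eqP]]]].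
  rewrite addn_eq0 => /andP[/eqP-> /eqP/size0nil->] /= vw.
  by right; split => //; exists s; split => //=; rewrite zs.
have [M HM] := eqv_act_eq zs; exists (maxn m M) => -[w i] [[]//|[_ /= Iw [t [/= tm wt tw]]]].
right; split => //; exists (s ++ t); split.
- by rewrite all_cat sm; apply: sub_all tm => k; rewrite geq_max => /andP[].
- by rewrite size_cat /= -yz -wt; lia.
- rewrite /= act_cat; case: i wt tw => [|i] wt /= tw; last first.
    by apply: eqv_trans tw; exact: eqv_act.
  rewrite -tw; apply: HM; first by case: (t) wt.
  by apply: sub_all tm => k; rewrite geq_max => /andP[].
Qed.

(** A common point of the two balls gives a word [s] leading from [y] and a word [t] with large
    letters leading from [z]; [sparse_cancel] removes [t] from [s], and the rest of [s] leads from
    [y] to [z]. *)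
Lemma gball_closed m y z : ~ gball m y z -> exists n, gball n z `&` gball m y = set0.
Proof.
move=> nyz; have [Iz|Iz] := pselect (I z.1).
  exists 0; rewrite -subset0 => w [[[_ Iw]|[]//] [[Iy _]|[]//]].
  by apply: nyz; left.
have [Iy|Iy] := pselect (I y.1).
  by exists 0; rewrite -subset0 => w [[[]//|[_ Iw _]] [[]//|[]]].
have [n Hn] := sparse_cancel (maxn y.2 z.2) Iy Iz.
exists n; rewrite -subset0 => w [[[]//|[_ Iw [t [tn wz tw]]]] [[]//|[_ _ [s [sm wy sw]]]]].
apply: nyz; right; split => //; case z2 : z.2 => [|l].
  move: wz tw; rewrite z2 => /eqP; rewrite addn_eq0 => /andP[/eqP w0 /eqP/size0nil->].
  by move: wy sw; rewrite w0 => wy /= sw zw; exists s; split => //=; rewrite sw.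
have [|||s' [s's ss' s'z]] := Hn s t _ _ tn; try by rewrite leq_max; lia.
  exact: eqv_trans (level_eqW sw) (eqv_sym (level_eqW tw)).
exists s'; split => //; first by apply/allP => i /s's; exact: (allP sm).
by rewrite -z2 -wz -addnA (addnC (size t)) ss'.
Qed.

Definition gbase : set_system (X * nat) := [set V | exists m y, V = gball m y].

Lemma graded_clopen_base : clopen_base graded_mul gbase.
Proof.
split.
- by move=> [u k] [v l] [w j]; rewrite /graded_mul /= (csgA hX) addnA.
- by move=> y; exists (gball 0 y); [exists 0, y|exact: gball_refl].
- move=> _ _ z [m [y ->]] [m' [y' ->]] /gball_open[n ny] /gball_open[n' ny'].
  exists (gball (maxn n n') z); split; first by exists (maxn n n'), z.
  + exact: gball_refl.
  + exact: subset_trans (gball_decr (leq_maxl _ _)) ny.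
  + exact: subset_trans (gball_decr (leq_maxr _ _)) ny'.
- move=> _ z [m [y ->]] /gball_closed[n nz]; exists (gball n z); split => //.
    by exists n, z.
  exact: gball_refl.
- move=> _ y z [m [w ->]] /gball_open[n nw]; exists (gball n y), (gball n z).
  split; [by exists n, y|by exists n, z|exact: gball_refl|exact: gball_refl|].
  move=> r s yr zs; apply: nw.
  case: yr => [[Iy Ir]|[Iy Ir [t [tn ry yr]]]].
    by left; split; [case: (Iideal z.1 Iy)|case: (Iideal s.1 Ir)].
  case: zs => [[Iz Is]|[Iz Is [t' [tn' sz zs]]]].
    by left; split; [case: (Iideal y.1 Iz)|case: (Iideal r.1 Is)].
  right; split; [exact: IM|exact: IM|exists (t ++ t'); split].
  + by rewrite all_cat tn.
  + by rewrite /= size_cat -ry -sz; lia.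
  + rewrite [X in level_eq _ X]/= act_cat act_mull (csgC hX (act y.1 t)) act_mull.
    by rewrite (csgC hX (act z.1 t')); exact: level_eqM.
Qed.

Lemma graded_not_closed (C : semigroup_class) :
  (forall (Y : topologicalType) (mulY : Y -> Y -> Y), TzS mulY -> C Y mulY) ->
  ~ quotient_C_closed C mul (rees_congr I).
Proof.
move=> hTz.
(* The limit point is g_0 a, the limit of the products g_0 g_n; its degree 1 separates it from
   [X]. *)
apply: (not_quotient_C_closed hTz (h := fun x => (x, 0)) (a := (g 0, 1)) graded_clopen_base).
- by [].
- move=> x y [->//|[Ix Iy]] _ [m [u ->]] [[Iu _]|[_ /(_ Ix)//]].
  by left.
- move=> x; exists (gball 0 (x, 0)); split; [by exists 0, (x, 0)|exact: gball_refl|].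
  move=> y [[Ix Iy]|[_ _ [s [_ /= /size0nil-> /=]]]]; first by right.
  by left.
- move=> _ [m [u ->]] /gball_open[n nu]; exists (g 0 * g n); apply: nu.
  right; split => /=; [exact: gI|by apply: IM; exact: gI|].
  by exists [:: n]; rewrite /= leqnn.
- move=> x; exists (gball 0 (x, 0)); split; [by exists 0, (x, 0)|exact: gball_refl|].
  by move=> [[_ /gI]|[_ _ [s []]]].
Qed.

End Graded.

Lemma graded_extension_not_closed (C : semigroup_class) :
  (forall (Y : topologicalType) (mulY : Y -> Y -> Y), TzS mulY -> C Y mulY) ->
  ~ quotient_C_closed C mul (rees_congr I).
Proof.
move=> hTz; have [g gP] := sparse_sequence.
have gT n : T n (g n) by case: (gP n).
by apply: (graded_not_closed gT _ hTz) => q s t c; case: (gP q) => _; exact.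
Qed.

End GradedExtension.

(** * Chains, powers and subgroups of an ideally closed semigroup *)

Lemma seq_eventually (T : eqType) (P : T -> nat -> Prop) (s : seq T) :
  (forall u, u \in s -> exists b, forall t, b <= t -> P u t) ->
  exists b, forall u t, u \in s -> b <= t -> P u t.
Proof.
elim: s => [|u s IH] H; first by exists 0.
have [|b Hb] := IH; first by move=> v vs; apply: H; rewrite inE vs orbT.
have [b' Hb'] := H u (mem_head _ _); exists (maxn b b') => v t.
rewrite inE geq_max => /orP[/eqP->|vs] /andP[bt b't]; [exact: Hb'|exact: Hb].
Qed.

Section Necessity.
Variables (C : semigroup_class).
Hypothesis hTz : forall (Y : topologicalType) (mulY : Y -> Y -> Y), TzS mulY -> C mulY.
Variables (X : Type) (mul : X -> X -> X).
Hypothesis hX : commutative_semigroup mul.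
Hypothesis closedX : ideally_C_closed C mul.
Local Notation "x * y" := (mul x y).
Local Notation pow := (spow mul).
Local Notation divides := (divides mul).
Local Notation idem := (idem mul).

Lemma ideally_closed_chain_finite : chain_finite mul.
Proof.
move=> D chainD; apply: contrapT => /infinite_injection[a ainj aD].
have [U Ufree] := free_ultrafilter_nat.
have ideal0 : ideal mul set0 by [].
apply: (term_not_closed hX ideal0 ainj _ _ Ufree hTz); last exact: closedX ideal0.
  by move=> n [].
by left=> i j; exact: chainD.
Qed.

Lemma not_dividing_pow_mul (Z : set X) : (forall y z, Z y -> Z z -> Z (y * z)) ->
  let I := [set x | forall z, Z z -> ~ divides x z] in forall x y, ~ I x -> ~ I y -> ~ I (x * y).
Proof.
move=> ZM /= x y /existsNP[z /not_implyP[Zz /contrapT xz]] /existsNP[t /not_implyP[Zt /contrapT yt]].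
by move=> /(_ _ (ZM _ _ Zz Zt)); apply; exact: divides_mul.
Qed.

Lemma ideally_closed_periodic x : exists n, idem (pow x n).
Proof.
apply: contrapT => Hx.
have powI m n : pow x m = pow x n -> m = n.
  wlog: m n / m <= n.
    by move=> H mn; case: (leqP m n) => [|/ltnW] /H -> //; exact: esym.
  rewrite leq_eqVlt => /orP[/eqP//|mn] e; exfalso; apply: Hx.
  by apply: (spow_collision hX (m := m) (p := n - m.+1)); rewrite e; congr pow; lia.
pose Z := range (pow x); pose I := [set y | forall z, Z z -> ~ divides y z].
pose T n := [set g | exists2 r, n <= r & g = pow x r].
have Ideal : ideal mul I := not_dividing_ideal hX (Z := Z).
have decr m n : m <= n -> T n `<=` T m.
  by move=> mn _ [r nr ->]; exists r => //; exact: leq_trans nr.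
(* Since [s] divides a power x^(k+1), a relation for multiples by [s] passes to [u] and [v] once the
   exponents are raised by k+1. *)
have cancel s u v : ~ I s -> eqv mul T (u * s) (v * s) -> eqv mul T u v.
  move=> /existsNP[_ /not_implyP[[k _ <-] /contrapT sk]] [m Hm].
  exists (m + k.+1)%N => _ [r mr ->].
  have -> : r = (k + (r - k.+1)).+1 by lia.
  rewrite (spowD hX); set g := pow x (r - _); have Hg : u * s * g = v * s * g.
    by apply: Hm; exists (r - k.+1) => //; lia.
  case: sk => [->|[z ->]]; first by rewrite !(csgA hX).
  by rewrite (csgAC hX s) !(csgA hX) Hg.
apply: (graded_extension_not_closed hX (T := T) Ideal _ _ _ cancel _ hTz).
- by apply: not_dividing_pow_mul => _ _ [m _ <-] [n _ <-]; exists (m + n).+1; rewrite ?spowD.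
- move=> n _ [r nr ->]; apply/existsNP; exists (pow x r) => H.
  by apply: (H _ (divides_refl _ _)); exists r.
- exact: decr.
- move=> n F.
  (* For fixed [u] and [v] outside [I], at most one [t] satisfies the relation: two of them would,
     after cancelling [v], identify distinct powers of [x]. Hence all large [t] avoid the finite
     list. *)
  have [b Hb] : exists b, forall u t, u \in F -> b <= t ->
      forall v, v \in F -> ~ I v -> ~ eqv mul T u (v * pow x t).
    apply: seq_eventually => u _.
    have [b Hb] : exists b, forall v t, v \in F -> b <= t ->
      ~ I v -> ~ eqv mul T u (v * pow x t).
      apply: seq_eventually => v _; have [Iv|Iv] := pselect (I v); first by exists 0.
      have [[t Ht]|nt] := pselect (exists t, eqv mul T u (v * pow x t)); last first.
        by exists 0 => t _ _ ut; apply: nt; exists t.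
      exists t.+1 => t' tt' _ Ht'; have := eqv_trans decr (eqv_sym Ht) Ht'.
      rewrite !(csgC hX v) => /(cancel _ _ _ Iv)[m Hm].
      have : pow x (t + m).+1 = pow x (t' + m).+1.
        by rewrite !(spowD hX); apply: Hm; exists m.
      by move/powI; lia.
    by exists b => t bt v vF; exact: Hb.
  exists (pow x (maxn n b)); first by exists (maxn n b); rewrite ?leq_maxl.
  move=> u v uF vF _ Iv c cn; rewrite (spow_spow hX); apply: Hb => //.
  by have := leq_maxr n b; nia.
- exact: closedX Ideal.
Qed.

Lemma unit_group_pow e x k : idem e -> unit_group mul e x -> unit_group mul e (pow x k).
Proof. by move=> ee xG; elim: k => //= k IH; rewrite -ee; exact: unit_groupM. Qed.

Lemma unit_group_cancel e x y : idem e -> unit_group mul e x -> unit_group mul e y ->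
  x = x * y -> y = e.
Proof.
move=> ee [xe [x' xx']] [ye _] xy.
by rewrite -ye (csgC hX) -xx' (csgAC hX) -xy.
Qed.

(* Pigeonhole on the powers h^((n+1)^t): their exponents, multiplied by at most n, remain distinct. *)
Lemma unit_group_bounded_of_finite e n (F : seq {classic X}) : idem e ->
  (forall h, unit_group mul e h -> exists2 c, c < n & (pow h c : {classic X}) \in F) ->
  exists m, forall h, unit_group mul e h -> pow h m = e.
Proof.
move=> ee HF.
have powG h k := @unit_group_pow e h k ee.
(* The collision below gives h^(b-a) = e with 0 < b-a <= (n+1)^(K+1); the factorial is a multiple of
   every such difference, which makes the exponent independent of [h]. *)
pose K := size F; exists ((n.+1 ^ K.+1)`!).-1 => h hG.
have /choice[c Hc] t : exists c, c < n /\ (pow (pow h (n.+1 ^ t).-1) c : {classic X}) \in F.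
  by have [c] := HF _ (powG h (n.+1 ^ t).-1 hG); exists c.
pose f t : {classic X} := pow (pow h (n.+1 ^ t).-1) (c t).
have : ~~ uniq (mkseq f K.+1).
  apply/negP => /uniq_leq_size-/(_ F).
  rewrite size_mkseq ltnn => H; suff : false by []; apply: H => _ /mapP[t _ ->].
  by case: (Hc t).
case/(uniqPn (h : {classic X})) => i [j [ij]]; rewrite size_mkseq => jK.
rewrite !nth_mkseq //; last exact: ltn_trans jK.
have pE t : (n.+1 ^ t).-1.+1 = n.+1 ^ t by rewrite prednK // expn_gt0.
rewrite /f !(spow_spow hX) !pE.
set a := (n.+1 ^ i * _)%N; set b := (n.+1 ^ j * _)%N => ab.
have a0 : 0 < a by rewrite muln_gt0 expn_gt0.
have alt : a < b.
  apply: (@leq_trans (n.+1 ^ i.+1)); first by rewrite /a expnSr ltn_pmul2l ?expn_gt0 //; case: (Hc i).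
  by apply: (@leq_trans (n.+1 ^ j)); [rewrite leq_pexp2l|rewrite /b leq_pmulr].
have bK : b <= n.+1 ^ K.+1.
  apply: (@leq_trans (n.+1 ^ j.+1)); last by rewrite leq_pexp2l.
  by rewrite /b expnSr leq_mul2l; case: (Hc j) => cj _; rewrite (leqW cj) orbT.
have he : pow h (b - a).-1 = e.
  apply: (unit_group_cancel ee (powG h a.-1 hG)); first exact: powG.
  by rewrite -(spowD hX) [LHS]ab; congr pow; lia.
have /dvdnP[q qE] : (b - a) %| (n.+1 ^ K.+1)`! by apply: dvdn_fact; lia.
have q0 : 0 < q by move: (fact_gt0 (n.+1 ^ K.+1)); rewrite qE; case: (q).
have -> : ((n.+1 ^ K.+1)`!).-1 = ((b - a).-1.+1 * q.-1.+1)%N.-1.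
  by rewrite qE mulnC !prednK //; lia.
by rewrite -(spow_spow hX) he idem_spow.
Qed.

Lemma ideally_closed_subgroups_bounded : all_subgroups_bounded mul.
Proof.
apply/(all_subgroups_boundedE hX) => e ee; apply: contrapT => unb.
pose I := [set y | forall z, [set e] z -> ~ divides y z].
pose T (n : nat) := unit_group mul e.
have Ideal : ideal mul I := not_dividing_ideal hX (Z := [set e]).
have IP s : ~ I s -> exists z, s * z = e.
  move=> /existsNP[_ /not_implyP[-> /contrapT[<-|[z zE]]]]; first by exists e.
  by exists z.
have cancel s u v : ~ I s -> eqv mul T (u * s) (v * s) -> eqv mul T u v.
  move=> /IP[z sz] [m Hm]; exists m => g gT.
  have E w : w * g = w * s * g * z.
    by rewrite -{1}[g]gT.1 -sz -!(csgA hX) (csgCA hX g).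
  by rewrite (E u) (E v) Hm.
apply: (graded_extension_not_closed hX (T := T) Ideal _ _ _ cancel _ hTz).
- by apply: not_dividing_pow_mul => _ _ -> ->.
- move=> _ x [xe [y xy]]; apply/existsNP; exists e => H.
  by apply: (H erefl); right; exists y.
- by move=> m n _ x.
- move=> n F; apply: contrapT => H; apply: unb.
  (* If every [g] in the group failed, u e = v g^(c+1) would hold for some listed [u], [v], so
     g^(c+1) = z(v) u e would lie in a finite set and the group would be bounded. *)
  have /choice[z zP] v : exists z, ~ I v -> v * z = e.
    by have [Iv|/IP[z vz]] := pselect (I v); [exists v|exists z].
  apply: (@unit_group_bounded_of_finite e n [seq (z v * u * e : {classic X}) | u <- F, v <- F]) => // g gG.
  apply: contrapT => Hg; apply: H; exists g => // u v uF vF Iu Iv c cn [m Hm].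
  apply: Hg; exists c => //.
  apply/(@allpairsP {classic X} {classic X}); exists (u, v); split => //=.
  have [pe _] := unit_group_pow c ee gG.
  rewrite -(csgA hX) Hm; last exact: unit_group_id.
  by rewrite -(csgA hX v) pe (csgA hX) (csgC hX (z v)) zP // (csgC hX) pe.
- exact: closedX Ideal.
Qed.
End Necessity.

(** * Non-Clifford elements *)

Lemma increasing_injective (f : nat -> nat) : (forall i j, i < j -> f i < f j) -> injective f.
Proof.
move=> fm i j fij; case: (ltngtP i j) => // /fm; lia.
Qed.

Section AlmostClifford.
Variables (C : semigroup_class).
Hypothesis hTz : forall (Y : topologicalType) (mulY : Y -> Y -> Y), TzS mulY -> C mulY.
Variables (X : Type) (mul : X -> X -> X).
Hypothesis hX : commutative_semigroup mul.
Hypothesis closedX : ideally_C_closed C mul.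
Local Notation "x * y" := (mul x y).
Local Notation pow := (spow mul).
Local Notation divides := (divides mul).
Local Notation idem := (idem mul).

Definition has_idem_pow (x e : X) := idem e /\ exists n, pow x n = e.

(** From x = x b z follows x = x (b z)^k for all k; the power of [b] equal to [e] gives x e = x.
    Since a power of [x] equals [e] too, [x] lies in the maximal subgroup at [e]. *)
Lemma absorbing_clifford x b e : has_idem_pow x e -> has_idem_pow b e ->
  divides (x * b) x -> clifford_part mul x.
Proof.
move=> [ee [m xm]] [_ [n bn]] xbx.
have absorb y k : x = x * y -> x = x * pow y k.
  by move=> xy; elim: k => //= k IH; rewrite (csgA hX) -xy.
have xe : x * e = x.
  case: xbx => [/(absorb _ n)|[z]]; first by rewrite bn.
  rewrite -(csgA hX) => /(absorb _ n); rewrite (spowMl hX) bn => xE.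
  by rewrite [in LHS]xE (csgC hX) !(csgCA hX e) (csgA hX e e) ee -xE.
by apply/(clifford_partE hX); exists e => //; exact: spow_unit_group xm.
Qed.

Lemma divides_idem_pow x y e f : has_idem_pow x e -> has_idem_pow y f -> divides x y -> e * f = f.
Proof.
move=> [ee [m xm]] [ff [n yn]] xy; rewrite (csgC hX); apply: (divides_idem hX ee).
have := divides_spow hX n (divides_spow hX m xy).
by rewrite xm (idem_spow n ee) (spow_spow hX y) mulnC -(spow_spow hX) yn (idem_spow m ff).
Qed.

(** By Ramsey the idempotents of a subsequence are all equal or pairwise distinct; distinct ones
    would form an infinite chain, because divisibility of elements orders their idempotents. *)
Lemma constant_idem_pow (a : nat -> X) :
  (forall i j, i < j -> divides (a i) (a j) \/ divides (a j) (a i)) ->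
  exists2 f, (forall i j, i < j -> f i < f j) & exists e, forall i, has_idem_pow (a (f i)) e.
Proof.
move=> comparable.
have /choice[p pP] x : exists e, has_idem_pow x e.
  by have [n xn] := ideally_closed_periodic hTz hX closedX x; exists (pow x n); split => //; exists n.
have [f fm fP] := ramsey_pairs (fun i j => p (a i) = p (a j)); exists f => //.
case: fP => [eq_p|neq_p].
  exists (p (a (f 0))) => i; case: (posnP i) => [->//|/eq_p ->]; exact: pP.
exfalso; pose q i := p (a (f i)).
apply: (@injection_infinite _ (range q) q) => [i j|n|]; last 1 first.
- apply: (ideally_closed_chain_finite hTz hX closedX) => _ _ [i _ <-] [j _ <-].
  wlog ij : i j / i < j.
    move=> H; case: (ltngtP i j) => [/H//|/H|->]; last by left; case: (pP (a (f j))).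
    by rewrite (csgC hX) => -[]; [right|left].
  case: (comparable (f i) (f j)); first exact: fm.
    by move=> /(divides_idem_pow (pP _) (pP _)); right.
  by move=> /(divides_idem_pow (pP _) (pP _)); rewrite (csgC hX); left.
- by case: (ltngtP i j) => // /neq_p // H /esym.
- by exists n.
Qed.

(** Nonsingularity of the Rees quotients: the sequence avoids the ideal of elements dividing nothing
    in [Z], while its products would fall into it. *)
Lemma not_nil_sequence (a : nat -> X) (Z : set X) : injective a ->
  (forall i, exists2 z, Z z & divides (a i) z) ->
  ~ (forall i j z, Z z -> ~ divides (a i * a j) z).
Proof.
move=> ainj aZ aaZ; have [U Ufree] := free_ultrafilter_nat.
have Ideal := not_dividing_ideal hX (Z := Z).
apply: (term_not_closed hX Ideal ainj _ _ Ufree hTz); last exact: closedX Ideal.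
  by move=> i H; have [z Zz] := aZ i; exact: H.
by right=> i j z; exact: aaZ.
Qed.

(** Ramsey is applied to b_i^2 | b_j. If it holds for all i < j, powers of b_0 divide later terms,
    so [e] divides a term, which is then Clifford. If it never holds, b_i b_j divides no b_k, since
    b_m^2 with m = min(i,j) would divide a later term; this contradicts [not_nil_sequence]. *)
Lemma no_ascending_sequence (a : nat -> X) : injective a ->
  (forall i, ~ clifford_part mul (a i)) -> ~ (forall i j, i < j -> divides (a i) (a j)).
Proof.
move=> ainj aN up.
have [|f fm [e ae]] := @constant_idem_pow a; first by move=> i j /up; left.
have [g gm gP] := ramsey_pairs (fun i j => divides (a (f i) * a (f i)) (a (f j))).
pose b := a \o f \o g.
have binj : injective b.
  by apply: inj_comp (increasing_injective gm); apply: inj_comp (increasing_injective fm).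
have bup i j : i <= j -> divides (b i) (b j).
  rewrite leq_eqVlt => /orP[/eqP->|ij]; first exact: divides_refl.
  exact/up/fm/gm.
case: gP => gP.
  have pow_div k : divides (pow (b 0) k) (b k.+1).
    elim: k => [|k IH]; first exact: bup.
    apply: (divides_trans hX _ (gP k.+1 k.+2 _)) => //=.
    by apply: (divides_mul hX) IH; exact: bup.
  have [ee [n bn]] : has_idem_pow (b 0) e := ae _.
  apply: (aN (f (g n.+1))); apply/(clifford_partE hX); exists e => //.
  have [_ [m am]] := ae (g n.+1); apply: spow_unit_group am => //.
  by apply: (divides_idem hX ee); rewrite -bn; exact: pow_div.
apply: (@not_nil_sequence b (range b)) => // [i|i j _ [k _ <-] bb].
  by exists (b i); [exists i|exact: divides_refl].
have mk : minn i j < (minn i j + k).+1 by lia.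
apply: gP mk _; apply: (divides_trans hX (y := b i * b j)).
  by apply: (divides_mul hX); apply: bup; [exact: geq_minl|exact: geq_minr].
apply: (divides_trans hX bb); apply: bup; lia.
Qed.

(* Along a chain with [b_j^2 | b_i] for [i < j], the cofactors [c_k = x / b_k] of [x = b_0]
   serve as the nil sequence: [c_i c_j] is a multiple of [x b_j], so it cannot divide [x]. *)
Lemma no_descending_sequence (a : nat -> X) : injective a ->
  (forall i, ~ clifford_part mul (a i)) -> ~ (forall i j, i < j -> divides (a j) (a i)).
Proof.
move=> ainj aN down.
have [|f fm [e ae]] := @constant_idem_pow a; first by move=> i j /down; right.
have [g gm gP] := ramsey_pairs (fun i j => divides (a (f j) * a (f j)) (a (f i))).
pose b := a \o f \o g.
have binj : injective b.
  by apply: inj_comp (increasing_injective gm); apply: inj_comp (increasing_injective fm).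
have be i : has_idem_pow (b i) e by exact: ae.
have bN i : ~ clifford_part mul (b i) by exact: aN.
have bdown i j : i <= j -> divides (b j) (b i).
  rewrite leq_eqVlt => /orP[/eqP->|ij]; first exact: divides_refl.
  exact/down/fm/gm.
case: gP => gP; last first.
  (* Here no b_m^2 with m > 0 divides b_0. A product of two of b_1, b_2, ... is a multiple of the
     square of the later factor, so it does not divide b_0. *)
  apply: (@not_nil_sequence (b \o succn) [set b 0]) => [|i|i j _ -> bb].
  - by apply: inj_comp binj succn_inj.
  - by exists (b 0) => //; exact: bdown.
  have mk : 0 < (maxn i j).+1 by [].
  apply: gP mk _; apply: (divides_trans hX _ bb).
  by apply: (divides_mul hX); apply: bdown; rewrite /= ltnS ?leq_maxl ?leq_maxr.
pose x := b 0.
(* The shift by 2 leaves room for two squarings: y^2 | b_1 and b_1^2 | b_0 give y^4 | x, so [y] has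
   a cofactor in [x] that is still a multiple of y^2. *)
have /choice[c cP] k : exists c, x = b k.+2 * c /\ divides (b k.+2 * b k.+2) c.
  set y := b k.+2; have : divides (y * y * (y * y)) x.
    apply: (divides_trans hX _ (gP 0 1 _)) => //.
    by apply: (divides_mul hX); exact: gP.
  case=> [->|[t ->]].
    by exists (y * (y * y)); rewrite !(csgA hX); split => //; exact: divides_mulr.
  exists (y * (y * y) * t); rewrite !(csgA hX); split => //.
  by rewrite -!(csgA hX) (csgA hX y); exact: divides_mulr.
have absorb j : ~ divides (x * b j.+2) x.
  by move=> /(absorbing_clifford (be _) (be _)); exact: bN.
apply: (@not_nil_sequence c [set x]).
- move=> i j; wlog ij : i j / i < j.
    by move=> H cc; case: (ltngtP i j) => // /H; [exact|move=> ->].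
  (* If c_i = c_j with i < j, then x b_(j+2) = b_(j+2)^2 c_j divides b_(i+2) c_i = x. *)
  move=> cc; exfalso; have [xi _] := cP i; have [xj _] := cP j.
  apply: (absorb j); rewrite {1}xj {1}xi cc (csgAC hX).
  by apply: (divides_mul hX) (divides_refl _ _); exact: gP.
- by move=> i; exists x => //; have [-> _] := cP i; exact: divides_mull.
- move=> i j _ ->; wlog ij : i j / i <= j.
    by move=> H; case: (leqP i j) => [/H//|/ltnW/H]; rewrite (csgC hX).
  have [_ ci] := cP i; have [xj _] := cP j.
  move=> cc; apply: (absorb j); apply: (divides_trans hX _ cc).
  rewrite {1}xj (csgAC hX); apply: (divides_mul hX) (divides_refl _ _).
  by apply: (divides_trans hX _ ci); apply: (divides_mul hX); apply: bdown.
Qed.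

(** Two applications of Ramsey leave an ascending sequence, a descending one or an antichain for
    divisibility. In an antichain, b_i b_j | b_k forces i = j = k, and then b_k^2 | b_k makes b_k
    Clifford. *)
Lemma ideally_closed_almost_clifford : almost_clifford mul.
Proof.
apply: contrapT => /infinite_injection[a ainj aN].
have [f fm fP] := ramsey_pairs (fun i j => divides (a i) (a j)).
have finj : injective (a \o f) by apply: inj_comp (increasing_injective fm).
case: fP => [up|nup]; first exact: (no_ascending_sequence finj (fun i => aN _) up).
have [g gm gP] := ramsey_pairs (fun i j => divides (a (f j)) (a (f i))).
have ginj : injective (a \o f \o g) by apply: inj_comp (increasing_injective gm).
case: gP => [down|ndown]; first exact: (no_descending_sequence ginj (fun i => aN _) down).
pose b := a \o f \o g.
have anti i j : divides (b i) (b j) -> i = j.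
  case: (ltngtP i j) => // ij bij; exfalso; first exact: (nup (g i) (g j) (gm _ _ ij)).
  exact: (ndown j i).
apply: (@not_nil_sequence b (range b)) => // [i|i j _ [k _ <-] bb].
  by exists (b i); [exists i|exact: divides_refl].
have ik : i = k by apply: anti; apply: (divides_trans hX _ bb); exact: divides_mulr.
have jk : j = k by apply: anti; apply: (divides_trans hX _ bb); exact: divides_mull.
have [n an] := ideally_closed_periodic hTz hX closedX (b k).
apply: (aN (f (g k))); apply: (@absorbing_clifford _ (b k) (pow (b k) n)).
- by split => //; exists n.
- by split => //; exists n.
- by rewrite ik jk in bb.
Qed.

End AlmostClifford.

(** * Closedness in T1 semigroups *)

Section Sufficiency.
Variables (Q : Type) (mul : Q -> Q -> Q).
Hypothesis hQ : commutative_semigroup mul.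
Local Notation "x * y" := (mul x y).
Local Notation pow := (spow mul).
Local Notation idem := (idem mul).
Local Notation unit_group := (unit_group mul).
Hypothesis cfQ : chain_finite mul.
Hypothesis acQ : almost_clifford mul.
Hypothesis bdQ : all_subgroups_bounded mul.
Variables (Y : topologicalType) (mY : Y -> Y -> Y).
Hypothesis hY : T1S mY.
Variable h : Q -> Y.
Hypothesis hM : forall x y, h (x * y) = mY (h x) (h y).
Hypothesis hinj : injective h.
Hypothesis hdisc : discrete_subspace (range h).

Lemma mY_assoc : associative mY. Proof. by case: hY => -[]. Qed.

Lemma mY_continuous (f g : Y -> Y) :
  continuous f -> continuous g -> continuous (fun z => mY (f z) (g z)).
Proof.
move=> cf cg z; have [[_ cm] _] := hY.
by apply: continuous2_cvg; [exact: (cm (f z, g z))|exact: cf|exact: cg].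
Qed.

Lemma spow_continuous n : continuous (fun z => spow mY z n).
Proof. by elim: n => [|n IH]; [move=> z; exact: cvg_id|apply: mY_continuous => // z; exact: cvg_id]. Qed.

Lemma hpow x n : h (pow x n) = spow mY (h x) n.
Proof. by elim: n => //= n <-; rewrite hM. Qed.

Section Limit.
Variables (y : Y) (G : set_system Q).
Context {GF : ProperFilter G}.
Hypothesis Gmax : forall A, G A \/ G (~` A).
Hypothesis Gy : forall O, nbhs y O -> G (h @^-1` O).
Hypothesis ny : ~ range h y.

Lemma T1_open (z w : Y) : z <> w -> exists A, [/\ open A, A z & ~ A w].
Proof.
move=> /eqP zw; have [_ /(_ _ _ zw)[A [oA]]] := hY.
by rewrite !inE => Az Aw; exists A.
Qed.

Lemma limit_free q : G [set p | p <> q].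
Proof.
have [|A [oA Ay nAq]] := @T1_open y (h q); first by move=> yq; apply: ny; exists q.
by apply: filterS (Gy (open_nbhs_nbhs (conj oA Ay))) => p Ap pq; apply: nAq; rewrite -pq.
Qed.

Lemma limit_const (f : Y -> Y) c : continuous f -> G [set q | f (h q) = c] -> f y = c.
Proof.
move=> cf fc; apply: contrapT => /T1_open[A [oA Ay nAc]].
have /Gy GA : nbhs y (f @^-1` A) by apply: cf; exact: open_nbhs_nbhs.
have [q [/= Aq qc]] := filter_ex (filterI GA fc).
by apply: nAc; rewrite -qc.
Qed.

Lemma limit_isolated (f : Y -> Y) (F : Q -> Q) d : continuous f ->
  (forall q, f (h q) = h (F q)) -> f y = h d -> G [set q | F q = d].
Proof.
move=> cf fF fy; have [|U [oU Ud]] := @hdisc (h d); first by exists d.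
have [hU _] : (U `&` range h) (h d) by rewrite Ud.
have /Gy : nbhs y (f @^-1` U) by apply: cf; rewrite fy; exact: open_nbhs_nbhs.
apply: filterS => q /=; rewrite fF => UF; apply: hinj.
by have : (U `&` range h) (h (F q)) by [split => //; exists (F q)]; rewrite Ud.
Qed.

(** By joint continuity the two factors vary independently over [K], so that distinct elements can
    be compared. *)
Lemma limit_isolated2 k d : mY y (spow mY y k) = h d ->
  exists2 K, G K & forall p q, K p -> K q -> p * pow q k = d.
Proof.
move=> yd; have [|U [oU Ud]] := @hdisc (h d); first by exists d.
have [hU _] : (U `&` range h) (h d) by rewrite Ud.
have [[_ cm] _] := hY.
have : nbhs (y, spow mY y k) ((fun p => mY p.1 p.2) @^-1` U).
  by apply: cm; rewrite /= yd; exact: open_nbhs_nbhs.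
case=> -[A B] /= [yA yB] AB.
exists (h @^-1` A `&` h @^-1` ((fun z => spow mY z k) @^-1` B)).
  by apply: filterI; apply: Gy => //; exact: spow_continuous.
move=> p q [Ap _] [_ Bq]; apply: hinj.
have : (U `&` range h) (h (p * pow q k)).
  by split; [rewrite hM hpow; exact: (AB (h p, _))|exists (p * pow q k)].
by rewrite Ud.
Qed.

(** Boundedness gives y^(n+1) = h(e), with n > 0 as [y] is outside the image. Then p q^n = e for
    independent [p], [q] in a large set, so two of its group elements share an inverse and coincide,
    against freeness. *)
Lemma limit_not_in_unit_group e : idem e -> ~ G (unit_group e).
Proof.
move=> ee Ge; have [n Hn] := (all_subgroups_boundedE hQ).1 bdQ e ee.
have : spow mY y n = h e.
  apply: (@limit_const (fun z => spow mY z n)); first exact: spow_continuous.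
  by apply: filterS Ge => q /Hn; rewrite /= -hpow => ->.
case: n Hn => [|k] Hn yn; first by apply: ny; exists e.
have [K GK Kp] := limit_isolated2 yn.
have [p [Kp1 ep]] := filter_ex (filterI GK Ge).
have [p' [[Kp' ep'] /=]] := filter_ex (filterI (filterI GK Ge) (limit_free p)); apply.
have pe : pow p k * p = e by rewrite (csgC hQ) -(Hn p ep).
by case: ep => pe' _; case: ep' => <- _; rewrite -pe (csgA hQ) Kp // (csgC hQ).
Qed.

Lemma limit_clifford : G (clifford_part mul).
Proof. by rewrite -[clifford_part mul]setCK; apply: free_filter_finite limit_free acQ. Qed.

Lemma limit_contradiction :
  (forall f, idem f -> range h (mY y (h f)) \/ G [set q | q * f = q]) -> False.
Proof.
move=> stable; have Gclif := limit_clifford.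
(* [u q] is the identity of the maximal subgroup containing [q], with an arbitrary value off the
   Clifford part. *)
have /choice[u uP] q : exists e, clifford_part mul q -> idem e /\ unit_group e q.
  have [/(clifford_partE hQ)[e ee eq]|nq] := pselect (clifford_part mul q); first by exists e.
  by exists q.
have uniqu q e : clifford_part mul q -> unit_group e q -> u q = e.
  by move=> /uP[_ uq]; exact: (unit_group_inj hQ).
pose good v := clifford_part mul v /\ range h (mY y (h (u v))).
have Ggood : G good.
  case: (Gmax good) => // ngood; exfalso.
  have GK : G (clifford_part mul `&` ~` good) by exact: filterI.
  (* Let [f] be a minimal unit of a bad element. As y f is outside the image, q f = q for almost
     every bad [q]; the unit of [q] is then below [f], hence equal to [f], and almost all elements
     lie in one maximal subgroup. *)
  pose P := [set e | exists2 v, (clifford_part mul `&` ~` good) v & e = u v].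
  have [||e e'|e e' f|e e'|f [v [vc vg] fv] fmin] := @idem_extremum _ _ hQ (fun e f => e * f = f) P cfQ.
  - by move=> _ [v [vc _] ->]; case: (uP v vc).
  - by have [v vK] := filter_ex GK; exists (u v), v.
  - by right.
  - by move=> ee' <-; rewrite (csgA hQ) ee'.
  - by move=> ee' e'e; rewrite -[LHS]e'e (csgC hQ).
  have [ff vf] := uP v vc; rewrite -fv in ff vf.
  have [yf|Gf] := stable f ff; first by apply: vg; split => //; rewrite -fv.
  apply: (limit_not_in_unit_group ff); apply: filterS (filterI GK Gf) => q [[qc qg] /= qf].
  have [qq qu] := uP q qc; have <- : u q = f => //; apply: fmin; first by exists q.
  have [_ [z qz]] := qu; rewrite -qz; by rewrite (csgA hQ) (csgC hQ f) qf.
(* If y y = h(c), then almost all squares equal [c], and [c] determines the unit; so almost all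
   elements lie in one maximal subgroup. *)
have nyy c : mY y y <> h c.
  move=> yy; have Gc : G [set q | q * q = c].
    apply: (@limit_isolated (fun z => mY z z)) yy; last by move=> q; rewrite hM.
    by apply: mY_continuous => z; exact: cvg_id.
  have [q [qc /= qq]] := filter_ex (filterI Gclif Gc); have [uq uqq] := uP q qc.
  apply: (limit_not_in_unit_group uq); apply: filterS (filterI Gclif Gc) => p [pc /= pp].
  have [up upp] := uP p pc; suff <- : u p = u q by [].
  apply: (unit_group_inj hQ (x := c)).
    by rewrite -pp -{1}up; exact: (unit_groupM hQ).
  by rewrite -qq -{1}uq; exact: (unit_groupM hQ).
pose Gam := [set g | [/\ idem g, range h (mY y (h g)) & G [set q | g * u q = g]]].
(* With y u(v) = h(d), almost all q u(v) equal [d]; hence u(q) u(v) is almost always the same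
   idempotent [g], and d v lies in its group. *)
have goodP v : good v -> exists d g, [/\ Gam g, mY y (h v) = h (d * v), unit_group g (d * v)
    & G [set q | u q * u v = g]].
  move=> [vc [d _ yd]]; have [uv uvv] := uP v vc.
  have Gd : G [set q | q * u v = d].
    apply: (@limit_isolated (fun z => mY z (h (u v)))) => //.
    by apply: mY_continuous => z; [exact: cvg_id|exact: cvg_cst].
  have Ud q : clifford_part mul q -> q * u v = d -> unit_group (u q * u v) d.
    by move=> /uP[uq uqq] <-; apply: (unit_groupM hQ) => //; exact: unit_group_id.
  have [q [qc /= qd]] := filter_ex (filterI Gclif Gd); have [uq uqq] := uP q qc.
  have Gg : G [set p | u p * u v = u q * u v].
    apply: filterS (filterI Gclif Gd) => p [pc /= pd].
    by apply: (unit_group_inj hQ (x := d)); exact: Ud.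
  exists d, (u q * u v); split => //.
  - split; first exact: idemM.
      by exists (d * u q) => //; rewrite (csgC hQ (u q)) !hM mY_assoc -yd.
    apply: filterS (filterI Gclif Gg) => p [/uP[up _] /= <-].
    by rewrite (csgC hQ (u p)) -(csgA hQ) up.
  - have [ve _] := uvv; rewrite -[in LHS]ve (csgC hQ v) !hM mY_assoc yd //.
  - have -> : u q * u v = u q * u v * u v by rewrite -(csgA hQ) uv.
    by apply: (unit_groupM hQ) => //; [exact: idemM|exact: Ud].
have [v0 /goodP[d0 [g0 [Gg0 _ _ _]]]] := filter_ex Ggood.
have [||e e'|e e' f|e e'|g [gg [c _ yc] Gg] gmax] := @idem_extremum _ _ hQ (fun e f => e * f = e) Gam cfQ.
- by move=> e [].
- by exists g0.
- by left.
- by move=> ee' e'f; rewrite -{1}ee' -(csgA hQ) e'f.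
- by move=> ee' e'e; rewrite -ee' (csgC hQ).
have Gc : G [set q | q * g = c].
  apply: (@limit_isolated (fun z => mY z (h g))) => //.
  by apply: mY_continuous => z; [exact: cvg_id|exact: cvg_cst].
(* For almost every [v], maximality makes the idempotent given by [goodP] equal to [g], and v g = c.
   Hence y v = y v g = y c = y g c = c c, and the limit over [v] gives y y = c c. *)
apply: (nyy (c * c)); apply: (@limit_const (mY y)).
  by apply: mY_continuous => z; [exact: cvg_cst|exact: cvg_id].
apply: filterS (filterI Ggood (filterI Gc Gg)) => v [/goodP[d [g' [Gg' yv dv Gq]]] [/= vc gv]].
have [q [/= qg' qg]] := filter_ex (filterI Gq Gg).
have gE : g' = g by apply: gmax => //; rewrite -qg' (csgA hQ) qg gv.
rewrite gE in dv; have [dvg _] := dv.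
have gc : g * c = c by rewrite -vc (csgCA hQ) gg.
by rewrite yv -dvg hM -yv -mY_assoc -hM vc -{1}gc hM mY_assoc -yc -hM.
Qed.

End Limit.
Lemma range_closed : closed (range h).
Proof.
move=> y cly; apply: contrapT => ny.
pose F : set_system Q := [set P | nbhs y (fun z => forall q, h q = z -> P q)].
have FF : ProperFilter F.
  apply: Build_ProperFilter_ex; last split.
  - by move=> P /cly[_ [[q _ <-] Pq]]; exists q; exact: Pq.
  - by apply: (@filterS _ (nbhs y) _ setT) filterT.
  - move=> P P' FP FP'; apply: (@filterS _ (nbhs y)) (@filterI _ (nbhs y) _ _ _ FP FP') => z [Pz P'z] q qz.
    by split; [exact: Pz|exact: P'z].
  - by move=> P P' PP'; apply: (@filterS _ (nbhs y)) => z Pz q /Pz/PP'.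
have [G [GU FG]] := ultraFilterLemma FF.
have Gmax A : G A \/ G (~` A) by exact: in_ultra_setVsetC.
have Gy O : nbhs y O -> G (h @^-1` O).
  by move=> yO; apply: FG; apply: filterS yO => z Oz q qz; rewrite /= qz.
have [all_in|] := pselect (forall e, idem e -> range h (mY y (h e))).
  by apply: (limit_contradiction Gmax Gy ny) => f /all_in; left.
move=> /existsNP[e0 /not_implyP[ee0 ye0]].
(* For a minimal [e] in [P], the point y e and the image of the filter under multiplication by [e]
   satisfy the hypothesis of [limit_contradiction]: if y e f is again outside the image, minimality
   forces e f = e. *)
pose P := [set e | idem e /\ ~ range h (mY y (h e))].
have [||e e'|e e' f|e e'|e [ee ye] emin] := @idem_extremum _ _ hQ (fun e f => e * f = f) P cfQ.
- by move=> e [].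
- by exists e0.
- by right.
- by move=> ee' <-; rewrite (csgA hQ) ee'.
- by move=> ee' e'e; rewrite -[LHS]e'e (csgC hQ).
pose Ge := fmap (fun q => q * e) G.
have GeF : ProperFilter Ge by exact: fmap_proper_filter.
apply: (@limit_contradiction (mY y (h e)) Ge) => //.
- by move=> A; exact: Gmax.
- move=> O yO; rewrite /Ge /fmap /=.
  have /Gy : nbhs y ((fun z => mY z (h e)) @^-1` O).
    by apply: mY_continuous yO => z; [exact: cvg_id|exact: cvg_cst].
  by apply: filterS => q /=; rewrite hM.
move=> f ff; have [yef|nyef] := pselect (range h (mY y (h (e * f)))).
  by left; rewrite -mY_assoc -hM.
right; have ef : e * f = e.
  by apply: emin; [split => //; exact: idemM|rewrite /= (csgA hQ) ee].
have : G setT by exact: filterT.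
by apply: (@filterS _ G) => q _ /=; rewrite -(csgA hQ) ef.
Qed.

End Sufficiency.

(** * Inheritance of the three conditions by homomorphic images *)

Section Image.
Variables (X : Type) (mul : X -> X -> X) (Q : Type) (mulQ : Q -> Q -> Q) (f : X -> Q).
Hypothesis hX : commutative_semigroup mul.
Hypothesis hQ : commutative_semigroup mulQ.
Hypothesis fM : forall x y, f (mul x y) = mulQ (f x) (f y).
Hypothesis f_surj : forall q, exists x, f x = q.
Hypothesis cfX : chain_finite mul.
Hypothesis acX : almost_clifford mul.
Hypothesis bdX : all_subgroups_bounded mul.

Lemma image_spow x n : f (spow mul x n) = spow mulQ (f x) n.
Proof. by elim: n => //= n <-; rewrite fM. Qed.

(** Either some power is Clifford, and boundedness makes a further power idempotent, or all powers
    lie in the finite non-Clifford part and two of them coincide. *)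
Lemma almost_clifford_bounded_periodic x : exists n, idem mul (spow mul x n).
Proof.
have clif y : clifford_part mul y -> exists n, idem mul (spow mul y n).
  move=> /(clifford_partE hX)[e ee ye]; have [n Hn] := (all_subgroups_boundedE hX).1 bdX e ee.
  by exists n; rewrite Hn.
have [[k /clif[n]]|nclif] := pselect (exists k, clifford_part mul (spow mul x k)).
  by rewrite (spow_spow hX) => H; exists (k.+1 * n.+1)%N.-1.
apply: contrapT => nper; apply: (@injection_infinite _ (~` clifford_part mul) (spow mul x)) => //.
  move=> i j ij; wlog lt_ij : i j ij / i < j.
    by move=> H; case: (ltngtP i j) => // [/H|/H/esym]; exact.
  exfalso; apply: nper; apply: (spow_collision hX (m := i) (p := j - i.+1)).
  by rewrite ij; congr spow; lia.
by move=> n xn; apply: nclif; exists n.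
Qed.

Lemma image_idem e : idem mul e -> idem mulQ (f e).
Proof. by rewrite /idem -fM => ->. Qed.

Lemma image_unit_group e x : unit_group mul e x -> unit_group mulQ (f e) (f x).
Proof. by move=> [xe [y xy]]; split; [rewrite -fM xe|exists (f y); rewrite -fM xy]. Qed.

(* An idempotent or a subgroup of the image lifts through the least idempotent above it in [X]. *)
Definition least_lift (q : Q) (e : X) := [/\ idem mul e, f e = q &
  forall e', idem mul e' -> f e' = q -> mul e e' = e].

(** Idempotents over [q] exist by periodicity and are closed under products, so a minimal one is
    least. *)
Lemma least_lift_exists q : idem mulQ q -> exists e, least_lift q e.
Proof.
move=> qq; pose P := [set e | idem mul e /\ f e = q].
have [||e e'|e e' g|e e'|e [ee fe] emin] := @idem_extremum _ _ hX (fun e g => mul e g = g) P cfX.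
- by move=> e [].
- have [x xq] := f_surj q; have [n xn] := almost_clifford_bounded_periodic x.
  by exists (spow mul x n); split => //; rewrite image_spow xq idem_spow.
- by right.
- by move=> ee' <-; rewrite (csgA hX) ee'.
- by move=> ee' e'e; rewrite -[LHS]e'e (csgC hX).
exists e; split => // e' ee' fe'; apply: emin; last by rewrite /= (csgA hX) ee.
by split; [exact: idemM|rewrite fM fe fe'].
Qed.

(** For p = f(x) in the group at [q], an idempotent power of [x] lies over [q], hence above [e].
    Then x e is in the group at [e] and f(x e) = p, so the exponent of that group works for [q]. *)
Lemma image_subgroups_bounded : all_subgroups_bounded mulQ.
Proof.
apply/(all_subgroups_boundedE hQ) => q qq; have [e [ee fe emin]] := least_lift_exists qq.
have [n Hn] := (all_subgroups_boundedE hX).1 bdX e ee; exists n => p pq.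
have [x xp] := f_surj p; have [k xk] := almost_clifford_bounded_periodic x.
have [pk _] := unit_group_pow hQ k qq pq.
have fxk : f (spow mul x k) = q.
  have [_ [r pr]] := unit_group_pow hQ k qq pq.
  have kk : mulQ (spow mulQ p k) (spow mulQ p k) = spow mulQ p k by rewrite -xp -image_spow -fM xk.
  by rewrite image_spow xp -pk -{1}pr (csgA hQ) kk pr.
have exk := emin _ xk fxk.
have xe : unit_group mul e (mul x e).
  apply: (spow_unit_group hX (n := k)) => //; first by rewrite -(csgA hX) ee.
  by rewrite (spowMl hX) (idem_spow k ee) (csgC hX).
have [pq' _] := pq.
by rewrite -pq' -xp -fe -fM -image_spow Hn.
Qed.

(** Least lifts preserve the order of idempotents, so they turn a chain into a chain of [X], which
    is finite and maps back onto the given one. *)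
Lemma image_chain_finite : chain_finite mulQ.
Proof.
move=> D chainD; have Did q : D q -> idem mulQ q by move=> Dq; case: (chainD q q Dq Dq).
have /choice[l lP] q : exists e, D q -> least_lift q e.
  by have [/Did/least_lift_exists[e]|nD] := pselect (D q); [exists e|have [x] := f_surj q; exists x].
have le p q : D p -> D q -> mulQ p q = p -> mul (l p) (l q) = l p.
  move=> Dp Dq pq; have [lp fp pmin] := lP p Dp; have [lq fq _] := lP q Dq.
  have := pmin (mul (l p) (l q)) (idemM hX lp lq) _.
  by rewrite fM fp fq pq (csgA hX) lp; exact.
have /(finite_image f) : finite_set (l @` D).
  apply: cfX => _ _ [p Dp <-] [q Dq <-]; case: (chainD p q Dp Dq) => pq.
    by left; exact: le.
  by right; rewrite (csgC hX); apply: le => //; rewrite (csgC hQ).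
apply: sub_finite_set => q Dq; exists (l q); first by exists q.
by case: (lP q Dq).
Qed.

Lemma image_almost_clifford : almost_clifford mulQ.
Proof.
apply: sub_finite_set (finite_image f acX) => q nq.
have [x xq] := f_surj q; exists x => // /(clifford_partE hX)[e ee xe].
apply: nq; apply/(clifford_partE hQ); exists (f e); first exact: image_idem.
by rewrite -xq; exact: image_unit_group.
Qed.

End Image.

(** * Closedness of all quotients and the equivalence *)

Lemma sufficient_projectively_closed (C : semigroup_class)
  (hT1 : forall (Y : topologicalType) (mulY : Y -> Y -> Y), C Y mulY -> T1S mulY)
  (X : Type) (mul : X -> X -> X) : commutative_semigroup mul ->
  chain_finite mul -> almost_clifford mul -> all_subgroups_bounded mul ->
  projectively_C_closed C mul.
Proof.
move=> hX cf ac bd R _ Y mY /hT1 hY h hM _ hdisc.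
pose Q := {y : Y | range h y}.
have Qmul (p q : Q) : range h (mY (sval p) (sval q)).
  by have [x _ <-] := svalP p; have [y _ <-] := svalP q; exists (mul x y); rewrite ?hM.
pose mulQ (p q : Q) : Q := exist _ _ (Qmul p q).
pose f (x : X) : Q := exist _ (h x) (ex_intro2 _ _ x I erefl).
have svalI : injective (sval : Q -> Y).
  move=> [p hp] [q hq] /= pq; case: _ / pq in hq *.
  by congr exist; exact: Prop_irrelevance.
have fM x y : f (mul x y) = mulQ (f x) (f y) by apply: svalI; rewrite /= hM.
have f_surj q : exists x, f x = q.
  by case: q => y [x xT xy]; exists x; apply: svalI.
have hQ : commutative_semigroup mulQ.
  split=> [p q r|p q]; last first.
    have [x <-] := f_surj p; have [y <-] := f_surj q.
    by rewrite -!fM (csgC hX).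
  have [x <-] := f_surj p; have [y <-] := f_surj q; have [z <-] := f_surj r.
  by rewrite -!fM (csgA hX).
have hE : range h = range (sval : Q -> Y).
  apply/seteqP; split => [_ [x _ <-]|_ [q _ <-]]; first by exists (f x).
  exact: svalP q.
rewrite hE in hdisc *.
apply: (range_closed hQ _ _ _ hY _ svalI hdisc) => //.
- exact: image_chain_finite hX hQ fM f_surj cf ac bd.
- exact: image_almost_clifford hX hQ fM f_surj ac.
- exact: image_subgroups_bounded hX hQ fM f_surj cf ac bd.
Qed.

Lemma rees_congruence (X : Type) (mul : X -> X -> X) (I : set X) :
  ideal mul I -> congruence mul (rees_congr I).
Proof.
move=> Iid; split.
- by left.
- by move=> x y [->|[Ix Iy]]; [left|right].
- by move=> x y z [->//|[Ix Iy]] [<-|[_ Iz]]; right.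
- move=> x y a [->|[Ix Iy]]; first by split; left.
  by have [xa ax] := Iid x a Ix; have [ya ay] := Iid y a Iy; split; right.
Qed.

Theorem theorem1p9 (C : semigroup_class)
  (hTz : forall (Y : topologicalType) (mulY : Y -> Y -> Y), TzS mulY -> C Y mulY)
  (hT1 : forall (Y : topologicalType) (mulY : Y -> Y -> Y), C Y mulY -> T1S mulY)
  (X : Type) (mul : X -> X -> X) (hX : commutative_semigroup mul) :
  (projectively_C_closed C mul <-> ideally_C_closed C mul) /\
  (ideally_C_closed C mul <->
     [/\ chain_finite mul, almost_clifford mul & all_subgroups_bounded mul]).
Proof.
have p_i : projectively_C_closed C mul -> ideally_C_closed C mul.
  by move=> H I /rees_congruence; exact: H.
have i_3 : ideally_C_closed C mul ->
    [/\ chain_finite mul, almost_clifford mul & all_subgroups_bounded mul].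
  move=> H; split; first exact: (@ideally_closed_chain_finite C hTz _ _ hX H).
    exact: (@ideally_closed_almost_clifford C hTz _ _ hX H).
  exact: (@ideally_closed_subgroups_bounded C hTz _ _ hX H).
have t_p : [/\ chain_finite mul, almost_clifford mul & all_subgroups_bounded mul] ->
    projectively_C_closed C mul.
  by case; exact: sufficient_projectively_closed.
by split; [split=> [/p_i|/i_3/t_p]|split=> [/i_3|/t_p/p_i]].
Qed.
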